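(* Let $X_{1},\ldots,X_{n}$ be independent, identically distributed real random variables with distribution function $F$ having a square integrable density $f$. Let $k:\mathbb{R}\to\mathbb{R}$ be a function that is symmetric about the origin, square integrable, and such that $\int_{-\infty}^{\infty}k(t)\,\mathrm{d}t=1$ and $\lim_{t\to\infty}t^{2}k(t)=0$. Let $K(z)=\int_{-\infty}^{z}k(x)\,\mathrm{d}x$, let $h>0$, and let $\widehat{F}(x;h)=\frac{1}{n}\sum_{i=1}^{n}K((x-X_{i})/h)$. Put $k_{h}(x)=k(x/h)/h$, $\eta(u)=(k_{h}\ast f)(u)$, and $$\xi(u)=(\eta\star\eta)(u)-2(\eta\star f)(u)+(f\star f)(u).$$ Then $\xi$ is symmetric about the origin and integrates to zero over the real line, and the integrated squared bias and integrated variance of $\widehat{F}(\cdot;h)$ are $$\mathrm{ISB}[\widehat{F}(\cdot;h)]=-\xi^{(-2)}(0),$$ $$\mathrm{IV}[\widehat{F}(\cdot;h)]=-\frac{h}{n}\psi(k)+\frac{1}{n}(\eta\star\eta)^{(-2)}(0),$$ where $\psi(k)=2\int_{-\infty}^{\infty}xK(x)k(x)\,\mathrm{d}x$.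
   Context: Convolution: $(f\ast g)(x)=\int_{-\infty}^{\infty}f(t)g(x-t)\,\mathrm{d}t$. Cross-correlation: $(f\star g)(x)=\int_{-\infty}^{\infty}f(t)g(t+x)\,\mathrm{d}t$. Antiderivatives: for a function $g$ on $\mathbb{R}$, $g^{(-1)}(x)=\int_{-\infty}^{x}g(u)\,\mathrm{d}u$ and $g^{(-2)}(x)=\int_{-\infty}^{x}g^{(-1)}(v)\,\mathrm{d}v$. Integrated squared bias: $\mathrm{ISB}[\widehat{F}(\cdot;h)]=\int_{-\infty}^{\infty}\{\mathrm{E}[\widehat{F}(x;h)]-F(x)\}^{2}\,\mathrm{d}x$. Integrated variance: $\mathrm{IV}[\widehat{F}(\cdot;h)]=\int_{-\infty}^{\infty}\mathrm{Var}[\widehat{F}(x;h)]\,\mathrm{d}x$.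
   Formalization: The integrated variance formula is stated only when xK(x)k(x) is Lebesgue integrable, i.e. ψ(k) is finite; otherwise, e.g. k(t)=c/((1+t²)ln(e+t²)) with f uniform on [0,1], the right side reads −∞+∞ although the integrated variance is finite. *)

(* Defs.v *)
From HB Require Import structures.
From mathcomp Require Import all_boot all_order all_algebra.
From mathcomp Require Import all_classical all_reals all_analysis.
Import Order.TTheory GRing.Theory Num.Theory.
Import numFieldNormedType.Exports.
Set Implicit Arguments.
Unset Strict Implicit.
Unset Printing Implicit Defensive.
Local Open Scope classical_set_scope.
Local Open Scope ring_scope.

(* Real-valued Lebesgue integrals below send an infinite value to 0; for square
   integrable f and g Cauchy-Schwarz makes both products integrable for every x,
   so this convention plays no role. *)

Definition convolution (R : realType) (f g : R -> R) (x : R) : R :=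
  \int[@lebesgue_measure R]_t (f t * g (x - t)).

Definition cross_correlation (R : realType) (f g : R -> R) (x : R) : R :=
  \int[@lebesgue_measure R]_t (f t * g (t + x)).

(* Extended-real valued: the iterated antiderivative g^(-2) may be infinite
   (for the cross-correlation of a density f with itself this happens exactly
   when f has no first moment). *)
Definition antiderivative (R : realType) (g : R -> \bar R) (x : R) : \bar R :=
  (\int[@lebesgue_measure R]_(u in `]-oo, x]) g u)%E.

Definition antiderivative2 (R : realType) (g : R -> R) (x : R) : \bar R :=
  antiderivative (antiderivative (EFin \o g)) x.

Definition mutually_independent d (T : measurableType d) (R : realType)
    (P : probability T R) (I : finType) (X : I -> {RV P >-> R}) : Prop :=
  forall (J : {set I}) (B : I -> set R),
    (forall i, i \in J -> measurable (B i)) ->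
    P (\bigcap_(i in [set` J]) (X i @^-1` B i)) =
    (\prod_(i in J) P (X i @^-1` B i))%E.

Definition has_density (R : realType) (F f : R -> R) : Prop :=
  [/\ measurable_fun setT f,
      forall x, 0 <= f x &
      forall x, (F x)%:E = antiderivative (EFin \o f) x].

Definition square_integrable (R : realType) (g : R -> R) : Prop :=
  g \in Lfun (@lebesgue_measure R) 2%:E.

Definition symmetric_about_origin (R : realType) (g : R -> R) : Prop :=
  forall x, g (- x) = g x.

Definition integrated_kernel (R : realType) (k : R -> R) (z : R) : R :=
  \int[@lebesgue_measure R]_(x in `]-oo, z]) k x.

Definition kernel_cdf_estimator d (T : measurableType d) (R : realType)
    (P : probability T R) (n : nat) (X : 'I_n -> {RV P >-> R}) (k : R -> R)
    (h : R) (x : R) : T -> R :=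
  fun w => n%:R^-1 * \sum_(i < n) integrated_kernel k ((x - X i w) / h).

Definition rescaled (R : realType) (k : R -> R) (h : R) (x : R) : R :=
  k (x / h) / h.

Definition smoothed_density (R : realType) (k : R -> R) (h : R) (f : R -> R) :
    R -> R :=
  convolution (rescaled k h) f.

Definition xi (R : realType) (eta f : R -> R) (u : R) : R :=
  cross_correlation eta eta u - 2 * cross_correlation eta f u
  + cross_correlation f f u.

Definition integrated_squared_bias d (T : measurableType d) (R : realType)
    (P : probability T R) (Fhat : R -> T -> R) (F : R -> R) : \bar R :=
  (\int[@lebesgue_measure R]_x ('E_P[Fhat x] - (F x)%:E) ^+ 2)%E.

Definition integrated_variance d (T : measurableType d) (R : realType)
    (P : probability T R) (Fhat : R -> T -> R) : \bar R :=
  (\int[@lebesgue_measure R]_x 'V_P[Fhat x])%E.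

(* Square integrability and t^2 k(t) -> 0 do not make x K(x) k(x) integrable:
   take k proportional to 1 / ((1 + t^2) ln (e + t^2)). psi k is then +oo, and
   so is (eta \star eta)^(-2)(0), so that the variance formula reads oo - oo
   although the variance may be finite. That formula is therefore stated for
   kernels whose psi_integrand is integrable. *)
Definition psi_integrand (R : realType) (k : R -> R) (x : R) : R :=
  x * integrated_kernel k x * k x.

Definition psi (R : realType) (k : R -> R) : \bar R :=
  (2%:E * \int[@lebesgue_measure R]_x (psi_integrand k x)%:E)%E.

(* Main.v *)
(* Write kap = k_h, eta = kap * f, let p be the cross-correlation of f with itself and Q
   its primitive. Since E K((x - X)/h) = (kap * F)(x), the bias is
   G(x) = \int kap(t) (F(x - t) - F(x)) dt, the primitive of g = eta - f, and xi is the
   cross-correlation of g with itself. If g has integral 0 and S is the primitive of s, an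
   integration by parts over ]-M, 0] gives
     \int_{-M}^0 (g \star s)^(-1) = - \int G(t) (S(t) - S(t - M)) dt.
   With s = g and M -> oo this is the bias formula. The primitive of xi is integrable although
   K - 1_{x >= 0} need not be: it is the second averaged increment
   \iint kap(t) kap(u) (Q(v - t - u) - Q(v - t) - Q(v - u) + Q(v)), and the increment of Q has
   an L1 norm at most 2 min(|t|, |u|) <= 2 sqrt |t| sqrt |u|, while t^2 k(t) -> 0 makes
   kap(t) sqrt |t| integrable. In the same way G is square integrable.
   If x K(x) k(x) is integrable then k has a first moment and G is integrable. The case
   s = eta + f, where g \star s = eta \star eta - f \star f, handles (kap * F)^2 - F^2, and
     E K((x - X)/h)^2 - (kap * F)^2 = F (1 - F) + \int w(t) (F(x - t) - F(x)) dt - G S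
   with w the derivative of K(x/h)^2. The first term integrates to p^(-2)(0), possibly +oo,
   and the second one to - \int t w(t) dt = - h psi(k). *)
Require Import Defs.
From HB Require Import structures.
From mathcomp Require Import all_boot all_order all_algebra.
From mathcomp Require Import all_classical all_reals all_analysis.
From mathcomp Require Import measurable_realfun.
From mathcomp Require Import ring lra.
Import Order.TTheory GRing.Theory Num.Theory.
Import numFieldNormedType.Exports.
Set Implicit Arguments.
Unset Strict Implicit.
Unset Printing Implicit Defensive.
Local Open Scope classical_set_scope.
Local Open Scope ring_scope.

(** * Fubini's theorem for real-valued integrals *)

(** [f] and [k] carry no regularity beyond integrability, so nothing can be differentiated
    pointwise. A primitive is encoded as [convolution f heaviside], and each integration by parts or
    chain rule is an exchange of two integrals followed by a translation. Such an exchange needs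
    absolute convergence, which a primitive, being merely bounded, does not give on the whole line;
    hence the cut-off and its boundary term. That term vanishes for two different reasons: a square
    integrable [G] decorrelates from its distant translates, while an integrable [G] dominates its
    product with a bounded function. Evenness of [k] enters through the equality of [eta \star f]
    and [f \star eta], without which [xi] would not be an autocorrelation. The half moment is the
    right exponent because the decay of [k] may leave the first moment infinite while [k(t) sqrt t]
    is [O(t^(-3/2))], and because a geometric mean, unlike a minimum, separates the two variables of
    a double average. In the variance, infinite values are confined to the single nonnegative
    integral of [F (1 - F)]; every other piece is finite, so no [oo - oo] arises. *)

Lemma ae_eq_integrable d (T : measurableType d) (R : realType)
    (m : {measure set T -> \bar R}) (f g : T -> \bar R) :
  measurable_fun setT g -> ae_eq m setT f g ->
  m.-integrable setT f -> m.-integrable setT g.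
Proof.
move=> mg fg /integrableP[mf fi]; apply/integrableP; split=> //.
rewrite -(@ae_eq_integral _ _ _ m setT (fun x => `|g x|)%E (fun x => `|f x|)%E measurableT)//.
- exact: measurableT_comp.
- exact: measurableT_comp.
- by apply: filterS fg => x fgx ?; rewrite fgx.
Qed.

Section parametrized_integrals.
Context d1 d2 (T1 : measurableType d1) (T2 : measurableType d2) (R : realType).
Variables (m1 : {sigma_finite_measure set T1 -> \bar R})
          (m2 : {sigma_finite_measure set T2 -> \bar R}).
Variable h : T1 -> T2 -> R.
Hypothesis mh : measurable_fun setT (fun p : T1 * T2 => h p.1 p.2).

Let mhE : measurable_fun setT (fun p : T1 * T2 => (h p.1 p.2)%:E).
Proof. exact/measurable_EFinP. Qed.

Lemma measurable_section2 x : measurable_fun setT (h x).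
Proof.
have mx : measurable_fun setT (fun y : T2 => (x, y)).
  by apply/measurable_fun_pairP; split; [exact: measurable_cst|exact: measurable_id].
exact: (measurableT_comp mh mx).
Qed.

(** Tonelli is applied to the positive and the negative part separately, so no integrability is
    required: a convolution is measurable even if its defining integral diverges at some points. *)
Lemma measurable_param_integral :
  measurable_fun setT (fun x => \int[m2]_y (h x y)%:E)%E.
Proof.
under eq_fun do rewrite integralE.
apply: emeasurable_funB.
- rewrite (_ : (fun _ => _) = fubini_F m2 (fun p : T1 * T2 => (h p.1 p.2)%:E)^\+%E).
    by apply: measurable_fun_fubini_tonelli_F => //; exact: measurable_funepos.
  by apply/funext => x; apply: eq_integral => y _; rewrite !funeposE.
- rewrite (_ : (fun _ => _) = fubini_F m2 (fun p : T1 * T2 => (h p.1 p.2)%:E)^\-%E).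
    by apply: measurable_fun_fubini_tonelli_F => //; exact: measurable_funeneg.
  by apply/funext => x; apply: eq_integral => y _; rewrite !funenegE.
Qed.

Lemma measurable_param_Rintegral :
  measurable_fun setT (fun x => \int[m2]_y h x y).
Proof. exact: measurableT_comp (measurable_param_integral). Qed.

(** Sections are integrable only for almost every [x], and elsewhere the real-valued integral is a
    default value. It is therefore compared with [fubini_F] almost everywhere. *)
Lemma integrable_param_Rintegral : (\int[m1]_x \int[m2]_y `|h x y|%:E < +oo)%E ->
  m1.-integrable setT (fun x => (\int[m2]_y h x y)%:E).
Proof.
move=> hfin.
have ih : (m1 \x m2)%E.-integrable setT (fun p : T1 * T2 => (h p.1 p.2)%:E).
  exact/integrable12ltyP.
have aeF : ae_eq m1 setT (fubini_F m2 (fun p : T1 * T2 => (h p.1 p.2)%:E))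
    (fun x => (\int[m2]_y h x y)%:E).
  apply: filterS (ae_integrable1 ih) => x ihx _.
  by rewrite /fubini_F /Rintegral fineK//; exact: integrable_fin_num.
apply: (ae_eq_integrable _ aeF (integrable_fubini_F ih)).
exact/measurable_EFinP/measurable_param_Rintegral.
Qed.

End parametrized_integrals.

Lemma Rfubini d1 d2 (T1 : measurableType d1) (T2 : measurableType d2)
    (R : realType) (m1 : {sigma_finite_measure set T1 -> \bar R})
    (m2 : {sigma_finite_measure set T2 -> \bar R}) (h : T1 -> T2 -> R) :
  measurable_fun setT (fun p : T1 * T2 => h p.1 p.2) ->
  (\int[m1]_x \int[m2]_y `|h x y|%:E < +oo)%E ->
  [/\ m1.-integrable setT (fun x => (\int[m2]_y h x y)%:E),
      m2.-integrable setT (fun y => (\int[m1]_x h x y)%:E) &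
      \int[m1]_x \int[m2]_y h x y = \int[m2]_y \int[m1]_x h x y].
Proof.
move=> mh hfin.
have mhs : measurable_fun setT (fun p : T2 * T1 => h p.2 p.1).
  apply: (measurableT_comp mh (g := fun p : T2 * T1 => (p.2, p.1))).
  by apply/measurable_fun_pairP; split; [exact: measurable_snd|exact: measurable_fst].
have ih : (m1 \x m2)%E.-integrable setT (fun p : T1 * T2 => (h p.1 p.2)%:E).
  exact/integrable12ltyP/hfin/measurable_EFinP.
have iF := integrable_param_Rintegral mh hfin.
have iG : m2.-integrable setT (fun y => (\int[m1]_x h x y)%:E).
  apply: (integrable_param_Rintegral (h := fun y x => h x y) mhs).
  by move: ih => /integrable21ltyP; apply; exact/measurable_EFinP.
split=> //; rewrite {1}/Rintegral [RHS]/Rintegral; congr fine.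
transitivity (\int[m1]_x fubini_F m2 (fun p : T1 * T2 => (h p.1 p.2)%:E) x)%E.
  apply: ae_eq_integral => //.
  - exact: (measurable_int m1 iF).
  - exact: (measurable_fubini_F ih).
  - apply: filterS (ae_integrable1 ih) => x ihx _.
    by rewrite /fubini_F /Rintegral fineK//; exact: integrable_fin_num.
transitivity (\int[m2]_y fubini_G m1 (fun p : T1 * T2 => (h p.1 p.2)%:E) y)%E.
  exact: Fubini ih.
apply: ae_eq_integral => //.
- exact: (measurable_fubini_G ih).
- exact: (measurable_int m2 iG).
- apply: filterS (ae_integrable2 ih) => y ihy _.
  by rewrite /fubini_G /Rintegral fineK//; exact: integrable_fin_num.
Qed.

Lemma Rfubini_le d1 d2 (T1 : measurableType d1) (T2 : measurableType d2)
    (R : realType) (m1 : {sigma_finite_measure set T1 -> \bar R})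
    (m2 : {sigma_finite_measure set T2 -> \bar R})
    (b : T1 -> R) (h : T1 -> T2 -> R) :
  measurable_fun setT (fun p : T1 * T2 => h p.1 p.2) ->
  m1.-integrable setT (EFin \o b) ->
  (forall x, \int[m2]_y `|h x y|%:E <= (b x)%:E)%E ->
  [/\ m1.-integrable setT (fun x => (\int[m2]_y h x y)%:E),
      m2.-integrable setT (fun y => (\int[m1]_x h x y)%:E) &
      \int[m1]_x \int[m2]_y h x y = \int[m2]_y \int[m1]_x h x y].
Proof.
move=> mh ib hb; apply: Rfubini => //.
apply: le_lt_trans (integrable_lty measurableT ib); apply: ge0_le_integral => //.
- by move=> x _; exact: integral_ge0.
- apply: (measurable_fun_fubini_tonelli_F (fun p : T1 * T2 => `|h p.1 p.2|%:E)) => //.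
  by apply/measurable_EFinP; exact: measurableT_comp.
- exact: (measurable_int m1 ib).
Qed.

(** The form of Fubini used for primitives: [e] is built from Heaviside factors or bounded
    increments, so that [|a x| * |b y| * C] dominates the integrand. *)
Lemma Rfubini_prod d1 d2 (T1 : measurableType d1) (T2 : measurableType d2)
    (R : realType) (m1 : {sigma_finite_measure set T1 -> \bar R})
    (m2 : {sigma_finite_measure set T2 -> \bar R})
    (a : T1 -> R) (b : T2 -> R) (e : T1 -> T2 -> R) (C : R) :
  m1.-integrable setT (EFin \o a) -> m2.-integrable setT (EFin \o b) ->
  measurable_fun setT (fun p : T1 * T2 => e p.1 p.2) ->
  (forall x y, `|e x y| <= C) ->
  [/\ m1.-integrable setT (fun x => (\int[m2]_y (a x * b y * e x y))%:E),
      m2.-integrable setT (fun y => (\int[m1]_x (a x * b y * e x y))%:E) &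
      \int[m1]_x \int[m2]_y (a x * b y * e x y) =
      \int[m2]_y \int[m1]_x (a x * b y * e x y)].
Proof.
move=> ia ib me eC.
have ma : measurable_fun setT a by exact/measurable_EFinP/(measurable_int m1 ia).
have mb : measurable_fun setT b by exact/measurable_EFinP/(measurable_int m2 ib).
have ma1 : measurable_fun setT (fun p : T1 * T2 => a p.1) by exact: measurableT_comp.
have mb2 : measurable_fun setT (fun p : T1 * T2 => b p.2) by exact: measurableT_comp.
apply: (@Rfubini_le _ _ _ _ _ _ _ (fun x => `|a x| * (\int[m2]_y `|b y| * C))).
- by apply: measurable_funM => //; exact: measurable_funM.
- rewrite /comp; under eq_fun do rewrite EFinM.
  apply: integrableZr => //; exact: integrable_norm.
- move=> x; apply: (@le_trans _ _ (\int[m2]_y ((`|a x| * C)%:E * `|b y|%:E))%E).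
    apply: ge0_le_integral => //.
    + apply/measurable_EFinP; apply: measurableT_comp => //.
      apply: (measurable_section2 (h := fun x y => a x * b y * e x y)).
      by apply: measurable_funM => //; exact: measurable_funM.
    + by apply: measurable_funeM; apply/measurable_EFinP; exact: measurableT_comp.
    + move=> y _; rewrite -EFinM lee_fin !normrM mulrAC.
      by rewrite ler_wpM2r// ler_wpM2l.
  rewrite integralZl//; last exact: integrable_norm.
  rewrite -[X in (_ * X <= _)%E]fineK; last exact/integrable_fin_num/integrable_norm.
  by rewrite -EFinM lee_fin -/(Rintegral m2 setT (fun y => `|b y|)) mulrAC mulrA.
Qed.

(** * Change of variables for the Lebesgue measure *)

Section change_of_variables.
Context {R : realType}.
Notation mu := (@lebesgue_measure R).
Local Open Scope ereal_scope.

(** The pushforward of Lebesgue measure by [phi], divided by [c], agrees with Lebesgue measure on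
    half-open intervals, hence everywhere by uniqueness. Translations, reflection and dilations are
    the instances. *)
Lemma ge0_integral_comp_scaling (phi : R -> R) (c : R) :
  measurable_fun setT phi -> (0 < c)%R ->
  (forall a b : R, mu (phi @^-1` `]a, b]) = c%:E * mu `]a, b]) ->
  forall f : R -> \bar R, measurable_fun setT f -> (forall x, 0 <= f x) ->
  \int[mu]_x f (phi x) = c%:E * \int[mu]_x f x.
Proof.
move=> mphi c0 muphi f mf f0.
have ci0 : (0 <= c^-1)%R by rewrite invr_ge0 ltW.
have mphi' : measurable_fun setT (phi : measurableTypeR R -> measurableTypeR R) by [].
pose pm := measure_function_pushforward__canonical__measure_function_Measure mu mphi'.
pose m' := mscale (NngNum ci0) pm.
have m'E : forall A, measurable A -> mu A = m' A.
  apply: lebesgue_measure_unique => _ [[a b] _ <-].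
  transitivity (c^-1%:E * (c%:E * mu `]a, b]%classic)).
    by rewrite muleA -EFinM mulVf ?mul1e// gt_eqF.
  by rewrite -muphi.
have -> : \int[mu]_x f x = \int[m']_x f x.
  by apply: eq_measure_integral => A mA _; exact: m'E.
rewrite ge0_integral_mscale//= muleA -EFinM mulfV ?gt_eqF// mul1e.
by rewrite ge0_integral_pushforward.
Qed.

Lemma integral_comp_scaling (phi : R -> R) (c : R) :
  measurable_fun setT phi -> (0 < c)%R ->
  (forall a b : R, mu (phi @^-1` `]a, b]) = c%:E * mu `]a, b]) ->
  forall f : R -> \bar R, measurable_fun setT f ->
  \int[mu]_x f (phi x) = c%:E * \int[mu]_x f x.
Proof.
move=> mphi c0 muphi f mf.
have fp : \int[mu]_x f^\+ (phi x) = c%:E * \int[mu]_x f^\+ x.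
  by apply: ge0_integral_comp_scaling => //; exact: measurable_funepos.
have fn : \int[mu]_x f^\- (phi x) = c%:E * \int[mu]_x f^\- x.
  by apply: ge0_integral_comp_scaling => //; exact: measurable_funeneg.
rewrite integralE [in RHS]integralE.
have -> : \int[mu]_x (fun x => f (phi x))^\+ x = c%:E * \int[mu]_x f^\+ x.
  by rewrite -fp; apply: eq_integral => x _; rewrite !funeposE.
have -> : \int[mu]_x (fun x => f (phi x))^\- x = c%:E * \int[mu]_x f^\- x.
  by rewrite -fn; apply: eq_integral => x _; rewrite !funenegE.
have : 0 <= \int[mu]_x f^\+ x by exact: integral_ge0.
have : 0 <= \int[mu]_x f^\- x by exact: integral_ge0.
have c0' : 0 < c%:E by rewrite lte_fin.
(* Nothing makes the two parts finite, so the infinite cases are checked by hand: a factor [c > 0]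
   preserves each infinity and the value of [oo - oo]. *)
case: (\int[mu]_x f^\- x) => [n| |]//; case: (\int[mu]_x f^\+ x) => [p| |]// _ _.
- exact: (congr1 EFin (esym (mulrBr _ _ _))).
- by rewrite gt0_muley// gt0_muley.
- by rewrite gt0_muley//= gt0_muleNy.
- by rewrite gt0_muley//= gt0_muleNy.
Qed.

Lemma integral_shift (a : R) (f : R -> \bar R) : measurable_fun setT f ->
  \int[mu]_x f (x + a)%R = \int[mu]_x f x.
Proof.
move=> mf; rewrite -[RHS]mul1e.
apply: (integral_comp_scaling (phi := fun x : R => (x + a)%R) (c := 1%R)) => //.
- exact: measurable_funD.
- move=> u v; rewrite mul1e.
  have -> : (fun x : R => (x + a)%R) @^-1` `]u, v] = `](u - a)%R, (v - a)%R]%classic.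
    by apply/seteqP; split=> x /=; rewrite !in_itv/= ltrBlDr lerBrDr.
  by rewrite !lebesgue_measure_itv/= !lte_fin ltrBlDr subrK -!EFinB; congr (if _ then _%:E else _); ring.
Qed.

Lemma integral_opp (f : R -> \bar R) : measurable_fun setT f ->
  \int[mu]_x f (- x)%R = \int[mu]_x f x.
Proof.
move=> mf; rewrite -[RHS]mul1e.
apply: (integral_comp_scaling (phi := fun x : R => (- x)%R) (c := 1%R)) => //.
  exact: oppr_measurable.
move=> u v; rewrite mul1e.
have -> : (fun x : R => (- x)%R) @^-1` `]u, v] = `[(- v)%R, (- u)%R[%classic.
  by apply/seteqP; split=> x /=; rewrite !in_itv/= lerNl ltrNr andbC.
by rewrite !lebesgue_measure_itv/= !lte_fin ltrN2 -!EFinB; congr (if _ then _%:E else _); ring.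
Qed.

Lemma integral_scale (a : R) (f : R -> \bar R) : (0 < a)%R -> measurable_fun setT f ->
  \int[mu]_x f (x / a)%R = a%:E * \int[mu]_x f x.
Proof.
move=> a0 mf.
apply: (integral_comp_scaling (phi := fun x : R => (x / a)%R)) => //.
- exact: measurable_funM.
- move=> u v.
  have -> : (fun x : R => (x / a)%R) @^-1` `]u, v] = `](u * a)%R, (v * a)%R]%classic.
    by apply/seteqP; split=> x /=; rewrite !in_itv/= ltr_pdivlMr// ler_pdivrMr.
  rewrite !lebesgue_measure_itv/= !lte_fin ltr_pM2r//.
  by case: ifPn => _; rewrite ?mule0// -!EFinB -EFinM; congr EFin; ring.
Qed.

End change_of_variables.

(** Measurability of atoms such as [f], [prim f] or [heaviside] is looked up in the context, which
    is why many proofs begin by restating those facts with [have]. *)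
Ltac mfun := repeat first
  [ assumption
  | exact: measurable_cst | exact: measurable_id
  | exact: measurable_fst | exact: measurable_snd
  | match goal with
    | H : measurable_fun setT ?F |- measurable_fun _ (fun x => ?F (@?g x)) =>
      apply: (measurableT_comp H (g := g))
    | |- measurable_fun _ (fun x => `|@?g x|) =>
      apply: (measurableT_comp (@normr_measurable _ setT) (g := g))
    end
  | apply: measurable_funD | apply: measurable_funB | apply: measurable_funM
  | apply: measurable_funN | apply: measurable_funX ].

(** * Integrable functions on the line and the Heaviside function *)

Section real_integrals.
Context {R : realType}.
Notation mu := (@lebesgue_measure R).
Notation L1 f := (mu.-integrable setT (EFin \o f)).
Implicit Types a b f g : R -> R.

Lemma measurable_L1 f : L1 f -> measurable_fun setT f.
Proof. by move=> fi; apply/measurable_EFinP; exact: (measurable_int mu fi). Qed.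

Lemma eq_L1 f g : f =1 g -> L1 f -> L1 g.
Proof. by move=> /funext ->. Qed.

Lemma L1D f g : L1 f -> L1 g -> L1 (fun x => f x + g x).
Proof. by move=> fi gi; have := integrableD measurableT fi gi. Qed.

Lemma L1N f : L1 f -> L1 (fun x => - f x).
Proof. by move=> fi; have := integrableN fi. Qed.

Lemma L1B f g : L1 f -> L1 g -> L1 (fun x => f x - g x).
Proof. by move=> fi gi; have := integrableB measurableT fi gi. Qed.

Lemma L1Z (c : R) f : L1 f -> L1 (fun x => c * f x).
Proof. by move=> fi; have := integrableZl measurableT c fi. Qed.

Lemma L1_norm f : L1 f -> L1 (fun x => `|f x|).
Proof. exact: integrable_norm. Qed.

Lemma le_L1 f g : measurable_fun setT f -> (forall x, `|f x| <= g x) -> L1 g -> L1 f.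
Proof.
move=> mf fg; apply: le_integrable => //; first exact/measurable_EFinP.
by move=> x _; rewrite lee_fin (le_trans (fg x)) ?ler_norm.
Qed.

Lemma L1_mul_bounded f g C : L1 f -> measurable_fun setT g ->
  (forall x, `|g x| <= C) -> L1 (fun x => f x * g x).
Proof.
move=> fi mg gC; apply: (@le_L1 _ (fun x => C * `|f x|)).
- by have mf := measurable_L1 fi; mfun.
- by move=> x; rewrite normrM mulrC ler_wpM2r.
- exact/L1Z/L1_norm.
Qed.

Lemma Rintegral_norm_mul_bounded f g C : L1 f -> measurable_fun setT g ->
  (forall x, `|g x| <= C) -> `|\int[mu]_x (f x * g x)| <= C * \int[mu]_x `|f x|.
Proof.
move=> fi mg gC; have fgi := L1_mul_bounded fi mg gC.
apply: (le_trans (le_normr_Rintegral _ fgi)) => //.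
rewrite -RintegralZl//; last exact: L1_norm.
apply: le_Rintegral => //; [exact: L1_norm|exact/L1Z/L1_norm|].
by move=> x _; rewrite normrM mulrC ler_wpM2r.
Qed.

Lemma Rintegral_shift c f : measurable_fun setT f ->
  \int[mu]_x f (x + c) = \int[mu]_x f x.
Proof.
move=> mf; congr fine; apply: (integral_shift c (f := EFin \o f)).
exact/measurable_EFinP.
Qed.

Lemma Rintegral_opp f : measurable_fun setT f ->
  \int[mu]_x f (- x) = \int[mu]_x f x.
Proof.
move=> mf; congr fine; apply: (integral_opp (f := EFin \o f)).
exact/measurable_EFinP.
Qed.

Lemma Rintegral_scale c f : 0 < c -> measurable_fun setT f ->
  \int[mu]_x f (x / c) = c * \int[mu]_x f x.
Proof.
move=> c0 mf; rewrite /Rintegral (integral_scale (f := EFin \o f))//; last first.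
  exact/measurable_EFinP.
by case: (\int[mu]_x _)%E => [r| |]//=; rewrite ?gt0_muley ?gt0_muleNy ?lte_fin ?mulr0.
Qed.

Lemma L1_shift c f : L1 f -> L1 (fun x => f (x + c)).
Proof.
move=> fi; have mf := measurable_L1 fi; apply/integrableP; split.
  by apply/measurable_EFinP; mfun.
case/integrableP : fi => _; rewrite -(integral_shift c)//.
by apply/measurable_EFinP; rewrite /=; mfun.
Qed.

Lemma L1_opp f : L1 f -> L1 (fun x => f (- x)).
Proof.
move=> fi; have mf := measurable_L1 fi; apply/integrableP; split.
  by apply/measurable_EFinP; mfun.
case/integrableP : fi => _; rewrite -integral_opp//.
by apply/measurable_EFinP; rewrite /=; mfun.
Qed.

Lemma L1_scale c f : 0 < c -> L1 f -> L1 (fun x => f (x / c)).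
Proof.
move=> c0 fi; have mf := measurable_L1 fi; apply/integrableP; split.
  by apply/measurable_EFinP; mfun.
case/integrableP : fi => _ fi.
rewrite (integral_scale (f := fun x => `|(EFin \o f) x|%E))//.
  by rewrite lte_mul_pinfty// lee_fin ltW.
by apply/measurable_EFinP; rewrite /=; mfun.
Qed.

Lemma L1_reflect c f : L1 f -> L1 (fun x => f (c - x)).
Proof.
move=> fi; apply: (@eq_L1 (fun x => f (- x + c))); first by move=> x; rewrite addrC.
exact: (L1_opp (f := fun x => f (x + c))) (L1_shift c fi).
Qed.

Lemma Rintegral_reflect c f : measurable_fun setT f ->
  \int[mu]_x f (c - x) = \int[mu]_x f x.
Proof.
move=> mf; rewrite -[RHS](Rintegral_shift c)// -[RHS]Rintegral_opp; last by mfun.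
by apply: eq_Rintegral => x _; rewrite addrC.
Qed.

(** With the value 1 at the origin, [heaviside (z - u)] is exactly the indicator of [u <= z]. Hence
    [convolution f heaviside] is the primitive of [f], and primitives obey the rules of
    convolutions. *)
Definition heaviside (t : R) : R := (0 <= t)%R%:R.

Lemma measurable_heaviside : measurable_fun setT heaviside.
Proof.
apply: nondecreasing_measurable => // s t st; rewrite /heaviside ler_nat.
by case: (leP 0 s) => // s0; rewrite (le_trans s0 st).
Qed.

Lemma heaviside_ge0 t : 0 <= heaviside t. Proof. by rewrite /heaviside. Qed.

Lemma heaviside_le1 t : heaviside t <= 1.
Proof. by rewrite /heaviside lern1 leq_b1. Qed.

Lemma heaviside_bounded t : `|heaviside t| <= 1.
Proof. by rewrite ger0_norm ?heaviside_ge0 ?heaviside_le1. Qed.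

Lemma integral_heaviside (g : R -> \bar R) z :
  (\int[mu]_(u in `]-oo, z]) g u = \int[mu]_u (g u * (heaviside (z - u))%:E))%E.
Proof.
rewrite integral_mkcond; apply: eq_integral => u _.
rewrite patchE /heaviside subr_ge0 mem_setE in_itv/=.
by case: ifPn => _; rewrite ?mule1 ?mule0.
Qed.

Lemma antiderivativeE f z : L1 f ->
  antiderivative (EFin \o f) z = (convolution f heaviside z)%:E.
Proof.
move=> fi; rewrite /antiderivative integral_heaviside /convolution /Rintegral fineK//.
apply: integrable_fin_num => //.
apply: (L1_mul_bounded (g := fun u => heaviside (z - u)) fi (C := 1)).
  by have mh := measurable_heaviside; mfun.
by move=> x; exact: heaviside_bounded.
Qed.

End real_integrals.

(** * Convolutions and primitives *)

Section convolutions.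
Context {R : realType}.
Notation mu := (@lebesgue_measure R).
Notation L1 f := (mu.-integrable setT (EFin \o f)).
Notation prim f := (convolution f heaviside).
Implicit Types a b f g phi : R -> R.

Lemma Rdominated_cvg (f_ : nat -> R -> R) f g :
  (forall n, measurable_fun setT (f_ n)) -> measurable_fun setT f ->
  (forall x, f_ n x @[n --> \oo] --> f x) ->
  (forall n x, `|f_ n x| <= g x) -> L1 g ->
  \int[mu]_x f_ n x @[n --> \oo] --> \int[mu]_x f x.
Proof.
move=> mf_ mf cf bf gi.
have cE x : (f_ n x)%:E @[n --> \oo] --> (f x)%:E by exact/(cvg_comp _ _ (cf x)).
have [//|//|fi _ cvgi] := @dominated_convergence _ _ _ mu setT measurableT
  (fun n => EFin \o f_ n) (EFin \o f) (EFin \o g)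
  (fun n => (measurable_EFinP _ _).2 (mf_ n)) ((measurable_EFinP _ _).2 mf) _ gi _.
- by apply: aeW => x _; exact: cE.
- by apply: aeW => x n _; rewrite lee_fin.
apply: fine_cvg; rewrite /Rintegral fineK//.
exact: integrable_fin_num.
Qed.

Lemma measurable_convolution f g : measurable_fun setT f -> measurable_fun setT g ->
  measurable_fun setT (convolution f g).
Proof.
move=> mf mg; apply: measurable_param_Rintegral.
by rewrite /=; mfun.
Qed.

Lemma measurable_cross_correlation f g : measurable_fun setT f -> measurable_fun setT g ->
  measurable_fun setT (cross_correlation f g).
Proof.
move=> mf mg; apply: measurable_param_Rintegral.
by rewrite /=; mfun.
Qed.

Lemma L1_heaviside z f : L1 f -> L1 (fun x => f x * heaviside (z - x)).
Proof.
move=> fi; apply: (L1_mul_bounded (C := 1)) => // [|x]; last exact: heaviside_bounded.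
by have mh := @measurable_heaviside R; mfun.
Qed.

Lemma measurable_primitive f : L1 f -> measurable_fun setT (prim f).
Proof.
by move=> /measurable_L1 mf; apply: measurable_convolution => //; exact: measurable_heaviside.
Qed.

Lemma primitive_bounded f z : L1 f -> `|prim f z| <= \int[mu]_x `|f x|.
Proof.
move=> fi; rewrite -[leRHS]mul1r; apply: Rintegral_norm_mul_bounded => // [|x].
  by have mh := @measurable_heaviside R; mfun.
exact: heaviside_bounded.
Qed.

Lemma primitiveD f g z : L1 f -> L1 g ->
  prim (fun x => f x + g x) z = prim f z + prim g z.
Proof.
move=> fi gi; rewrite /convolution -RintegralD//; try exact: L1_heaviside.
by apply: eq_Rintegral => x _; rewrite mulrDl.
Qed.

Lemma primitiveB f g z : L1 f -> L1 g ->
  prim (fun x => f x - g x) z = prim f z - prim g z.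
Proof.
move=> fi gi; rewrite /convolution -RintegralB//; try exact: L1_heaviside.
by apply: eq_Rintegral => x _; rewrite mulrBl.
Qed.

Lemma primitive_compl f c : L1 f ->
  \int[mu]_t (f t * heaviside (t - c)) = \int[mu]_t f t - prim f c.
Proof.
move=> fi; have mh := @measurable_heaviside R; have mf := measurable_L1 fi.
have fhi : L1 (fun t => f t * heaviside (t - c)).
  by apply: (L1_mul_bounded (C := 1)) => // [|x]; [mfun|exact: heaviside_bounded].
apply/eqP; rewrite eq_sym subr_eq /convolution -RintegralD//; last exact: L1_heaviside.
apply/eqP; congr fine; apply: ae_eq_integral => //.
- exact/measurable_EFinP.
- by apply/measurable_EFinP; mfun.
(* Both Heaviside factors are 1 at [t = c], so they add up to 1 only off this null set. *)
exists [set c]; split => //; first exact: lebesgue_measure_set1.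
move=> t /= /not_implyP[_]; apply: contra_notP => /eqP tc.
congr EFin; rewrite -mulrDr /heaviside !subr_ge0.
by case: (ltgtP t c) tc; rewrite ?addr0 ?add0r ?mulr1.
Qed.

Section pairing.
Variables a b : R -> R.
Hypotheses (ai : L1 a) (bi : L1 b).
Let ma := measurable_L1 ai.
Let mb := measurable_L1 bi.

Section convolution_pairing.
Hypothesis abi : forall y, L1 (fun s => a s * b (y - s)).

Lemma convolution_pairing phi C : measurable_fun setT phi ->
  (forall s, \int[mu]_y `|b y * phi (y + s)|%:E <= C%:E)%E ->
  \int[mu]_y (convolution a b y * phi y) =
  \int[mu]_s (a s * \int[mu]_y (b y * phi (y + s))).
Proof.
move=> mphi phiC.
have bphii s : L1 (fun y => b (y - s) * phi y).
  apply: (@eq_L1 _ (fun y => b (y - s) * phi ((y - s) + s))); first by move=> y; rewrite subrK.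
  apply: (L1_shift (- s) (f := fun y => b y * phi (y + s))).
  apply/integrableP; split; last by rewrite (le_lt_trans (phiC s))// ltry.
  by apply/measurable_EFinP; mfun.
transitivity (\int[mu]_y \int[mu]_s (a s * (b (y - s) * phi y))).
  apply: eq_Rintegral => y _; rewrite /convolution -RintegralZr//.
  by apply: eq_Rintegral => s _; rewrite mulrA.
have [|||_ _ <-] := @Rfubini_le _ _ _ _ R mu mu (fun s => `|a s| * C)
  (fun s y => a s * (b (y - s) * phi y)).
- by mfun.
- apply: (L1_mul_bounded (f := fun s => `|a s|) (C := `|C|)) => //; exact: L1_norm.
- move=> s; rewrite EFinM; apply: le_trans (lee_wpmul2l _ (phiC s)); last by rewrite lee_fin.
  rewrite -ge0_integralZl//; [|by apply/measurable_EFinP; mfun].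
  rewrite -[leRHS](integral_shift (- s)); last first.
    by apply/measurable_EFinP; mfun.
  rewrite le_eqVlt; apply/orP; left; apply/eqP; apply: eq_integral => y _.
  by rewrite subrK -EFinM -normrM.
- apply: eq_Rintegral => s _; rewrite RintegralZl//; congr (_ * _).
  rewrite -[LHS](Rintegral_shift s); last by mfun.
  by apply: eq_Rintegral => y _; rewrite addrK.
Qed.

Lemma L1_convolution : L1 (convolution a b).
Proof.
have [||| _ ? _] := @Rfubini_le _ _ _ _ R mu mu (fun s => `|a s| * \int[mu]_y `|b y|)
  (fun s y => a s * b (y - s)).
- by mfun.
- apply: (L1_mul_bounded (f := fun s => `|a s|) (C := `|\int[mu]_y `|b y| |)) => //.
  exact: L1_norm.
- move=> s; under eq_integral do rewrite normrM EFinM.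
  rewrite ge0_integralZl//; [|by apply/measurable_EFinP; mfun].
  rewrite EFinM lee_wpmul2l ?lee_fin//.
  rewrite (integral_shift (- s) (f := fun y => `|b y|%:E)); last by apply/measurable_EFinP; mfun.
  by rewrite /Rintegral fineK//; exact/integrable_fin_num/L1_norm.
- by [].
Qed.

Lemma convolution_pairing_bounded phi C : measurable_fun setT phi ->
  (forall x, `|phi x| <= C) ->
  \int[mu]_y (convolution a b y * phi y) =
  \int[mu]_s (a s * \int[mu]_y (b y * phi (y + s))).
Proof.
move=> mphi phiC; apply: (@convolution_pairing _ (C * \int[mu]_y `|b y|)) => // s.
have bpi : L1 (fun y => `|b y * phi (y + s)|).
  by apply/L1_norm/(L1_mul_bounded (C := C)) => //; mfun.
rewrite -[leLHS]fineK; last exact: (integrable_fin_num _ bpi).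
rewrite lee_fin -RintegralZl//; last exact: L1_norm.
apply: le_Rintegral => //; first exact/L1Z/L1_norm.
by move=> y _; rewrite normrM mulrC ler_wpM2r.
Qed.

(** This is associativity of convolution with [heaviside] as third factor, obtained by pairing with
    the bounded function [heaviside (z - y)]. *)
Lemma primitive_convolution z : prim (convolution a b) z = convolution a (prim b) z.
Proof.
have mh := @measurable_heaviside R.
rewrite /convolution (convolution_pairing_bounded (phi := fun y => heaviside (z - y)) (C := 1)).
- apply: eq_Rintegral => s _; congr (_ * _).
  by apply: eq_Rintegral => y _; rewrite opprD addrA addrAC.
- by mfun.
- by move=> x; exact: heaviside_bounded.
Qed.

Lemma Rintegral_convolution :
  \int[mu]_y convolution a b y = \int[mu]_s a s * \int[mu]_y b y.
Proof.
under eq_Rintegral do rewrite -[convolution _ _ _]mulr1.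
rewrite (convolution_pairing_bounded (phi := cst 1) (C := 1)) => //; last by move=> x; rewrite normr1.
under eq_Rintegral do under eq_Rintegral do rewrite mulr1.
by rewrite RintegralZr.
Qed.

End convolution_pairing.
End pairing.
End convolutions.

(** * Cross-correlations *)

Section cross_correlations.
Context {R : realType}.
Notation mu := (@lebesgue_measure R).
Notation L1 f := (mu.-integrable setT (EFin \o f)).
Notation prim f := (convolution f heaviside).
Implicit Types a b f g phi : R -> R.

Lemma cvg_heaviside_subn (x : R) : heaviside (x - n%:R) @[n --> \oo] --> (0 : R).
Proof.
apply: cvg_near_cst; near=> n.
rewrite /heaviside subr_ge0 leNgt (_ : x < n%:R)//.
by near: n; exact: nbhs_infty_gtr.
Unshelve. all: by end_near. Qed.

Lemma cvg_primitive_subn f y : L1 f -> prim f (y - n%:R) @[n --> \oo] --> (0 : R).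
Proof.
move=> fi; have mf := measurable_L1 fi; have mh := @measurable_heaviside R.
rewrite (_ : 0 = \int[mu]_x (cst 0 x)); last by rewrite /Rintegral integral0.
apply: (Rdominated_cvg (g := fun x => `|f x|)).
- by move=> n; mfun.
- by [].
- move=> x; rewrite (_ : cst 0 x = f x * 0); last by rewrite mulr0.
  apply: cvgM; first exact: cvg_cst.
  by under eq_fun do rewrite addrAC; exact: cvg_heaviside_subn.
- by move=> n x; rewrite normrM -[leRHS]mulr1 ler_wpM2l// heaviside_bounded.
- exact: L1_norm.
Qed.

Lemma cvg_primitive_addn f y : L1 f ->
  prim f (y + n%:R) @[n --> \oo] --> \int[mu]_x f x.
Proof.
move=> fi; have mf := measurable_L1 fi; have mh := @measurable_heaviside R.
apply: (Rdominated_cvg (g := fun x => `|f x|)).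
- by move=> n; mfun.
- by [].
- move=> x; rewrite -[X in _ --> X]mulr1.
  apply: cvgM; first exact: cvg_cst.
  apply: cvg_near_cst; near=> n.
  rewrite /heaviside subr_ge0 -lerBlDl ltW//.
  by near: n; exact: nbhs_infty_gtr.
- by move=> n x; rewrite normrM -[leRHS]mulr1 ler_wpM2l// heaviside_bounded.
- exact: L1_norm.
Unshelve. all: by end_near. Qed.

Lemma cross_correlationE a b u : measurable_fun setT a -> measurable_fun setT b ->
  cross_correlation a b u = convolution (fun s => a (- s)) b u.
Proof.
move=> ma mb; rewrite /cross_correlation -Rintegral_opp; last by mfun.
by apply: eq_Rintegral => s _; rewrite addrC.
Qed.

Lemma cross_correlation_sym a b u : measurable_fun setT a -> measurable_fun setT b ->
  cross_correlation a b (- u) = cross_correlation b a u.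
Proof.
move=> ma mb; rewrite /cross_correlation -(Rintegral_shift u); last by mfun.
by apply: eq_Rintegral => t _; rewrite addrK mulrC.
Qed.

Section pair.
Variables a b : R -> R.
Hypotheses (ai : L1 a) (bi : L1 b).
Let ma := measurable_L1 ai.
Let mb := measurable_L1 bi.
Let mh := @measurable_heaviside R.

Section integrable_products.
Hypothesis abi : forall u, L1 (fun t => a t * b (t + u)).

Let abi' y : L1 (fun s => a (- s) * b (y - s)).
Proof.
apply: eq_L1 (L1_opp (abi y)) => s; by rewrite addrC.
Qed.

Let corrE : cross_correlation a b = convolution (fun s => a (- s)) b.
Proof. by apply/funext => u; exact: cross_correlationE. Qed.

Lemma L1_cross_correlation : L1 (cross_correlation a b).
Proof. by rewrite corrE; apply: L1_convolution => //; exact: L1_opp. Qed.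

Lemma Rintegral_cross_correlation :
  \int[mu]_u cross_correlation a b u = \int[mu]_t a t * \int[mu]_t b t.
Proof.
rewrite corrE Rintegral_convolution//; last exact: L1_opp.
by rewrite Rintegral_opp.
Qed.

Lemma primitive_cross_correlation v :
  prim (cross_correlation a b) v = cross_correlation a (prim b) v.
Proof.
rewrite corrE (primitive_convolution (L1_opp ai) bi abi').
by rewrite cross_correlationE//; exact: measurable_primitive.
Qed.

End integrable_products.

(** After the exchange, [b w] is multiplied by the integral of [a] over [t >= w - v]. Since [a] has
    mass zero, this upper tail is minus the lower one, [prim a (w - v)]. *)
Lemma cross_correlation_primitiveC v : \int[mu]_x a x = 0 ->
  cross_correlation a (prim b) v = - cross_correlation (prim a) b v.
Proof.
move=> a0; rewrite /cross_correlation {1}/convolution.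
transitivity (\int[mu]_t \int[mu]_w (a t * b w * heaviside (t + v - w))).
  apply: eq_Rintegral => t _; rewrite -RintegralZl//; last exact: L1_heaviside.
  by apply: eq_Rintegral => w _; rewrite mulrA.
have [||_ _ ->] := @Rfubini_prod _ _ _ _ R mu mu a b (fun t w => heaviside (t + v - w)) 1 ai bi.
- by mfun.
- by move=> t w; exact: heaviside_bounded.
transitivity (\int[mu]_w (- (prim a (w - v) * b w))).
  apply: eq_Rintegral => w _.
  transitivity (\int[mu]_t (b w * (a t * heaviside (t - (w - v))))).
    apply: eq_Rintegral => t _; rewrite mulrCA mulrA opprB addrA.
    by congr (_ * heaviside _); ring.
  rewrite RintegralZl//; last first.
    by apply: (L1_mul_bounded (C := 1)) => // [|x]; [mfun|exact: heaviside_bounded].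
  by rewrite primitive_compl// a0 sub0r mulrN mulrC.
have pi : L1 (fun w => prim a (w - v) * b w).
  apply: (@eq_L1 _ (fun w => b w * prim a (w - v))); first by move=> w; rewrite mulrC.
  have mp := measurable_primitive ai.
  by apply: (L1_mul_bounded (C := \int[mu]_x `|a x|)) => // [|x]; [mfun|exact: primitive_bounded].
under eq_Rintegral do rewrite -mulN1r.
rewrite RintegralZl// mulN1r; congr (- _).
rewrite -(Rintegral_shift v); last exact: measurable_L1 pi.
by apply: eq_Rintegral => t _; rewrite addrK.
Qed.

(** The indicator of []-n, 0]]. As a difference of Heaviside functions, it turns an integral of [b]
    over a translated window into a difference of two values of [prim b]. *)
Let window n (v : R) : R := heaviside (- v) - heaviside (- v - n%:R).

Let mwindow n : measurable_fun setT (window n).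
Proof. by rewrite /window; mfun. Qed.

Let windowi n : L1 (window n).
Proof.
apply: eq_L1 (integrable_indic_itv (- n%:R) 0 false false) => v.
rewrite indicE mem_setE in_itv/= /window /heaviside subr_ge0 oppr_ge0.
have n0 : (- n%:R : R) <= 0 by rewrite oppr_le0.
rewrite ltNge lerNr; case: (leP v 0) => v0/=; last first.
  by rewrite leNgt (lt_le_trans _ (_ : 0 <= n%:R)) ?subr0//= oppr_lt0.
by rewrite andbT; case: (leP n%:R (- v)); rewrite ?subrr ?subr0.
Qed.

(** The window has finite length and [b] is integrable, so the double integral converges absolutely
    although [prim a] is only bounded. *)
Lemma window_cross_correlation n :
  \int[mu]_v (window n v * cross_correlation (prim a) b v) =
  \int[mu]_y (prim a y * (prim b y - prim b (y - n%:R))).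
Proof.
have mp := measurable_primitive ai.
set C := \int[mu]_x `|a x|.
have pC y : `|prim a y| <= C by exact: primitive_bounded.
have C0 : 0 <= C by exact: le_trans (pC 0).
have bpi v : L1 (fun y => prim a y * b (y + v)).
  apply: (@eq_L1 _ (fun y => b (y + v) * prim a y)); first by move=> y; rewrite mulrC.
  by apply: (L1_mul_bounded (C := C)) => //; exact: L1_shift.
transitivity (\int[mu]_v \int[mu]_y (window n v * (prim a y * b (y + v)))).
  by apply: eq_Rintegral => v _; rewrite /cross_correlation -RintegralZl.
have [|||_ _ ->] := @Rfubini_le _ _ _ _ R mu mu
    (fun v => `|window n v| * (C * \int[mu]_x `|b x|))
    (fun v y => window n v * (prim a y * b (y + v))).
- by have := mwindow n => mw; mfun.
- rewrite /comp; under eq_fun do rewrite mulrC.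
  exact/L1Z/L1_norm.
- move=> v; under eq_integral do rewrite normrM EFinM.
  have bpi' := L1_norm (bpi v).
  rewrite (@integralZl _ _ _ mu setT measurableT _ bpi') EFinM lee_wpmul2l ?lee_fin//.
  rewrite -[leLHS]fineK; last exact: (integrable_fin_num _ bpi').
  rewrite lee_fin -(Rintegral_shift v (f := fun x => `|b x|)); last by mfun.
  have bvi := L1_norm (L1_shift v bi).
  rewrite -RintegralZl//; apply: le_Rintegral => //; first exact: L1Z.
  by move=> y _; rewrite normrM ler_wpM2r.
- apply: eq_Rintegral => y _.
  transitivity (\int[mu]_v (prim a y * (b (v + y) * window n (v + y - y)))).
    by apply: eq_Rintegral => v _; rewrite addrK mulrCA (addrC y) (mulrC (b _)).
  have wi : L1 (fun v => b v * window n (v - y)).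
    apply: (L1_mul_bounded (C := 1 + 1)) => // [|v]; first by have := mwindow n => mw; mfun.
    by rewrite (le_trans (ler_normB _ _))// lerD// heaviside_bounded.
  rewrite RintegralZl//; last exact: (L1_shift y wi).
  congr (_ * _); rewrite (Rintegral_shift y (f := fun v => b v * window n (v - y))); last exact: measurable_L1 wi.
  rewrite /convolution -RintegralB//; try exact: L1_heaviside.
  by apply: eq_Rintegral => v _; rewrite /window mulrBr opprB (addrAC y).
Qed.

(* Integrate by parts over ]-n, 0] and let n tend to infinity: the limit in the last
   hypothesis is that of the boundary term. *)
Lemma antiderivative2_cross_correlation :
  (forall u, L1 (fun t => a t * b (t + u))) -> \int[mu]_x a x = 0 ->
  L1 (prim (cross_correlation a b)) ->
  L1 (fun y => prim a y * prim b y) ->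
  (forall n, L1 (fun y => prim a y * prim b (y - n%:R))) ->
  \int[mu]_y (prim a y * prim b (y - n%:R)) @[n --> \oo] --> (0 : R) ->
  antiderivative2 (cross_correlation a b) 0 =
  (- \int[mu]_y (prim a y * prim b y))%:E.
Proof.
move=> abi a0 Ai pp ppn lim0.
have ci := L1_cross_correlation.
rewrite /antiderivative2.
rewrite (_ : antiderivative (EFin \o cross_correlation a b) = EFin \o prim (cross_correlation a b)); last first.
  by apply/funext => v; rewrite antiderivativeE.
rewrite antiderivativeE//; congr EFin.
set A := prim (cross_correlation a b).
have mA := measurable_L1 Ai.
have AE v : A v = - cross_correlation (prim a) b v.
  by rewrite /A primitive_cross_correlation// cross_correlation_primitiveC.
(* The truncated integrals have two limits, one by dominated convergence and one through
   [window_cross_correlation]; equating them is the claim. *)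
have lim1 : \int[mu]_v (A v * window n v) @[n --> \oo] --> prim A 0.
  apply: (Rdominated_cvg (g := fun v => `|A v| * (1 + 1))).
  - by move=> n; have := mwindow n => mw; mfun.
  - by mfun.
  - move=> v; apply: cvgM; first exact: cvg_cst.
    rewrite /window sub0r -[X in _ --> X]subr0; apply: cvgB; first exact: cvg_cst.
    exact: cvg_heaviside_subn.
  - move=> n v; rewrite normrM ler_wpM2l//.
    by rewrite (le_trans (ler_normB _ _))// lerD// heaviside_bounded.
  - rewrite /comp; under eq_fun do rewrite mulrC.
    exact/L1Z/L1_norm.
have lim2 : \int[mu]_v (A v * window n v) @[n --> \oo] -->
    - (\int[mu]_y (prim a y * prim b y) - 0).
  have step n : \int[mu]_v (A v * window n v) =
      - (\int[mu]_y (prim a y * prim b y) - \int[mu]_y (prim a y * prim b (y - n%:R))).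
    have Awi : L1 (fun v => A v * window n v).
      apply: (L1_mul_bounded (C := 1 + 1)) => // v.
      by rewrite /window (le_trans (ler_normB _ _))// lerD// heaviside_bounded.
    rewrite -RintegralB//.
    transitivity (- \int[mu]_y (prim a y * (prim b y - prim b (y - n%:R)))); last first.
      by congr (- _); apply: eq_Rintegral => y _; rewrite mulrBr.
    rewrite -window_cross_correlation -mulN1r -RintegralZl//; last first.
      by apply: eq_L1 (L1N Awi) => v; rewrite AE mulNr opprK mulrC.
    by apply: eq_Rintegral => v _; rewrite AE mulN1r mulNr mulrC.
  under eq_fun do rewrite step.
  by apply: cvgN; apply: cvgB => //; exact: cvg_cst.
by rewrite subr0 in lim2; exact: (cvg_unique _ lim1 lim2).
Qed.

End pair.
End cross_correlations.

(** * Averaged increments *)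

(** The shift precedes the point, so that [increment f x] is again a function on the line and
    increments can be iterated. *)
HB.lock Definition increment {R : realType} (f : R -> R) (x y : R) : R :=
  f (y - x) - f y.

(** For [kap] of mass 1 and bounded [f] this is [convolution kap f - f]. Keeping the difference
    under the integral sign retains the cancellation on which the norm estimates rest. *)
HB.lock Definition avg_increment {R : realType} (kap f : R -> R) (y : R) : R :=
  \int[@lebesgue_measure R]_x (kap x * increment f x y).

Section increments.
Context {R : realType}.
Notation mu := (@lebesgue_measure R).
Notation L1 f := (mu.-integrable setT (EFin \o f)).
Notation prim f := (convolution f heaviside).
Implicit Types a b f g p kap : R -> R.

Lemma incrementE f x y : increment f x y = f (y - x) - f y.
Proof. by rewrite increment.unlock. Qed.

Lemma avg_incrementE kap f y :
  avg_increment kap f y = \int[mu]_x (kap x * increment f x y).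
Proof. by rewrite avg_increment.unlock. Qed.

Lemma measurable_increment f x : measurable_fun setT f ->
  measurable_fun setT (increment f x).
Proof. by move=> mf; rewrite increment.unlock/=; mfun. Qed.

Let L1_heaviside_increment x : 0 <= x -> L1 (increment heaviside x) /\
  \int[mu]_y increment heaviside x y = - x.
Proof.
move=> x0.
have e y : increment heaviside x y = - \1_(`[0, x[%classic) y.
  rewrite indicE mem_setE in_itv/= incrementE /heaviside subr_ge0.
  case: (leP 0 y) => y0/=; last by rewrite leNgt (lt_le_trans y0 x0) subrr oppr0.
  by case: (leP x y) => _; rewrite ?subrr ?oppr0 ?sub0r.
have i1 := integrable_indic_itv 0 x true true.
split; first by apply: eq_L1 (L1N i1) => y; rewrite e.
under eq_Rintegral do rewrite e -mulN1r.
rewrite RintegralZl// mulN1r; congr (- _).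
rewrite /Rintegral integral_indic// setIT.
transitivity (fine (mu `[0, x[%classic)); first by [].
rewrite lebesgue_measure_itv/= lte_fin.
by move: x0; rewrite le_eqVlt => /orP[/eqP <-|->]; rewrite ?ltxx//= oppr0 addr0.
Qed.

Lemma increment_primitive p x y : L1 p ->
  increment (prim p) x y = \int[mu]_u (p u * increment heaviside x (y - u)).
Proof.
move=> pi; rewrite incrementE /convolution -RintegralB//; try exact: L1_heaviside.
by apply: eq_Rintegral => u _; rewrite incrementE mulrBr (addrAC y).
Qed.

(** The increment of [prim p] superposes, with weights [p u], translates of the increment of
    [heaviside], which for [x >= 0] is minus the indicator of [[0, x[]. A negative shift is the
    opposite of a positive one, seen from a translated point. *)
Lemma L1_increment_primitive p x : L1 p -> L1 (increment (prim p) x) /\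
  \int[mu]_y increment (prim p) x y = - x * \int[mu]_u p u.
Proof.
move=> pi; wlog x0 : x / 0 <= x.
  move=> h; have [|x0] := leP 0 x; first exact: h.
  have [|hi he] := h (- x); first by rewrite oppr_ge0 ltW.
  have e y : increment (prim p) x y = - increment (prim p) (- x) (y - x).
    by rewrite !incrementE opprK subrK opprB.
  split; first by apply: eq_L1 (L1N (L1_shift (- x) hi)) => y; rewrite e.
  under eq_Rintegral do rewrite e -mulN1r.
  rewrite RintegralZl//; last exact: (L1_shift (- x) hi).
  rewrite (Rintegral_shift (- x)) ?he; last exact: measurable_L1.
  by rewrite opprK mulN1r mulNr.
have [hi he] := L1_heaviside_increment x0.
have mh := measurable_increment x (@measurable_heaviside R).
have mp := measurable_L1 pi.
have hxi u : L1 (fun y => increment heaviside x (y - u)) by exact: (L1_shift (- u) hi).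
have [|||_ h1 h2] := @Rfubini_le _ _ _ _ R mu mu
    (fun u => `|p u| * \int[mu]_y `|increment heaviside x y|)
    (fun u y => p u * increment heaviside x (y - u)).
- by mfun.
- rewrite /comp; under eq_fun do rewrite mulrC.
  exact/L1Z/L1_norm.
- move=> u; under eq_integral do rewrite normrM EFinM.
  rewrite integralZl//; last exact: L1_norm (hxi u).
  rewrite EFinM lee_wpmul2l ?lee_fin//.
  rewrite (integral_shift (- u) (f := fun y => `|increment heaviside x y|%:E)); last first.
    by apply/measurable_EFinP; mfun.
  by rewrite /Rintegral fineK//; exact/integrable_fin_num/L1_norm.
- split; first by apply: eq_L1 h1 => y; rewrite increment_primitive.
  under eq_Rintegral do rewrite increment_primitive//.
  transitivity (\int[mu]_u \int[mu]_y (p u * increment heaviside x (y - u))); first exact (esym h2).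
  rewrite -(RintegralZl (- x) measurableT pi); apply: eq_Rintegral => u _.
  by rewrite (RintegralZl (p u) measurableT (hxi u)) (Rintegral_shift (- u))// he mulrC.
Qed.

Lemma le_primitive p y z : L1 p -> (forall x, 0 <= p x) -> y <= z ->
  prim p y <= prim p z.
Proof.
move=> pi p0 yz; apply: le_Rintegral; rewrite //; try exact: L1_heaviside.
move=> x _; rewrite ler_wpM2l// /heaviside ler_nat !subr_ge0.
by case: (leP x y) => // xy; rewrite (le_trans xy yz).
Qed.

Lemma primitive_ge0 p y : (forall x, 0 <= p x) -> 0 <= prim p y.
Proof.
by move=> p0; apply: Rintegral_ge0 => x _; rewrite mulr_ge0 ?heaviside_ge0.
Qed.

Lemma primitive_le p y : L1 p -> (forall x, 0 <= p x) -> prim p y <= \int[mu]_x p x.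
Proof.
move=> pi p0; apply: le_Rintegral => //; first exact: L1_heaviside.
by move=> x _; rewrite -[leRHS]mulr1 ler_wpM2l// heaviside_le1.
Qed.

Section density.
Variable p : R -> R.
Hypotheses (pi : L1 p) (p0 : forall x, 0 <= p x) (p1 : \int[mu]_x p x = 1).

Lemma increment_primitive_le1 x y : `|increment (prim p) x y| <= 1.
Proof.
have h z : 0 <= prim p z <= 1 by rewrite primitive_ge0//= -p1 primitive_le.
rewrite incrementE ler_norml; move: (h y) (h (y - x)); lra.
Qed.

(** The primitive of a density is monotone, so its increment has constant sign and its norm is the
    absolute value of its integral [- x]. *)
Lemma Rintegral_norm_increment x :
  \int[mu]_y `|increment (prim p) x y| = `|x|.
Proof.
have [ii ie] := L1_increment_primitive x pi; rewrite p1 mulr1 in ie.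
have [x0|x0] := leP 0 x.
- rewrite ger0_norm// -[RHS]opprK -ie -mulN1r -RintegralZl//.
  apply: eq_Rintegral => y _; rewrite mulN1r ler0_norm// incrementE subr_le0.
  by apply: le_primitive => //; rewrite gerBl.
- rewrite ltr0_norm// -ie; apply: eq_Rintegral => y _; rewrite ger0_norm//.
  by rewrite incrementE subr_ge0; apply: le_primitive => //; rewrite lerDl oppr_ge0 ltW.
Qed.

End density.

(** Minkowski's integral inequality for the L1 norm. At a point [v] where the inner integral is
    infinite its real value is 0, which only helps the inequality. *)
Lemma Rminkowski_le b (h : R -> R -> R) :
  measurable_fun setT (fun q : R * R => h q.1 q.2) -> L1 b ->
  (forall s, \int[mu]_v `|h s v|%:E <= (b s)%:E)%E ->
  (\int[mu]_v `|\int[mu]_s h s v|%:E <= (\int[mu]_s b s)%:E)%E.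
Proof.
move=> mh bi hb.
have mhs : measurable_fun setT (fun q : R * R => h q.2 q.1).
  apply: (measurableT_comp mh (g := fun q : R * R => (q.2, q.1))).
  by apply/measurable_fun_pairP; split; [exact: measurable_snd|exact: measurable_fst].
have mhn : measurable_fun setT (fun q : R * R => `|h q.1 q.2|%:E).
  by apply/measurable_EFinP; exact: measurableT_comp.
have mhsn : measurable_fun setT (fun q : R * R => `|h q.2 q.1|%:E).
  by apply/measurable_EFinP; exact: measurableT_comp.
apply: (@le_trans _ _ (\int[mu]_v \int[mu]_s `|h s v|%:E)%E).
  apply: ge0_le_integral => //.
  - apply/measurable_EFinP; apply: measurableT_comp => //.
    exact: (@measurable_param_Rintegral _ _ _ _ _ mu (fun v s => h s v) mhs).
  - by apply: (@measurable_fun_fubini_tonelli_F _ _ _ _ R mu (fun q : R * R => `|h q.2 q.1|%:E)).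
  - move=> v _; apply: (@le_trans _ _ `|\int[mu]_s (h s v)%:E|%E).
      by rewrite /Rintegral; case: (\int[mu]_s _)%E => [r| |]//=; rewrite ?normr0 ?leey.
    apply: le_abse_integral => //; apply/measurable_EFinP.
    exact: (measurable_section2 (h := fun v s => h s v) mhs).
have -> : (\int[mu]_v \int[mu]_s `|h s v|%:E = \int[mu]_s \int[mu]_v `|h s v|%:E)%E.
  by apply: (@fubini_tonelli _ _ _ _ R mu mu (fun q : R * R => `|h q.2 q.1|%:E)).
rewrite /Rintegral fineK; last exact: integrable_fin_num.
apply: ge0_le_integral => //.
- by move=> s _; exact: integral_ge0.
- by apply: (@measurable_fun_fubini_tonelli_F _ _ _ _ R mu (fun q : R * R => `|h q.1 q.2|%:E)).
- exact: (measurable_int mu bi).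
Qed.

Lemma L1_le_fin f C : measurable_fun setT f ->
  (\int[mu]_v `|f v|%:E <= C%:E)%E -> L1 f.
Proof.
move=> mf fC; apply/integrableP; split; first exact/measurable_EFinP.
by rewrite (le_lt_trans fC)// ltry.
Qed.

Lemma integral_norm_L1 f : L1 f -> (\int[mu]_v `|f v|%:E)%E = (\int[mu]_v `|f v|)%:E.
Proof. by move=> fi; rewrite /Rintegral fineK//; exact/integrable_fin_num/L1_norm. Qed.

Lemma increment_norm_le f x : L1 f ->
  L1 (increment f x) /\ \int[mu]_y `|increment f x y| <= 2 * \int[mu]_y `|f y|.
Proof.
move=> fi; have fxi := L1_shift (- x) fi; have mf := measurable_L1 fi.
split; first by apply: eq_L1 (L1B fxi fi) => y; rewrite incrementE.
rewrite mulr_natl mulr2n -{1}(Rintegral_shift (- x) (f := fun y => `|f y|)); last by mfun.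
rewrite -RintegralD//; [|exact: (L1_norm fxi)|exact: L1_norm].
apply: le_Rintegral => //.
  by apply: eq_L1 (L1_norm (L1B fxi fi)) => y; rewrite incrementE.
  by apply: L1D; [exact: (L1_norm fxi)|exact: L1_norm].
by move=> y _; rewrite incrementE; exact: ler_normB.
Qed.

(** Bounding a minimum by a geometric mean factors a double average over [x] and [s] into a product
    of two half moments. *)
Lemma le_sqrtM (z x s : R) : 0 <= z -> z <= x -> z <= s ->
  z <= Num.sqrt x * Num.sqrt s.
Proof.
move=> z0 zx zs; rewrite -sqrtrM ?(le_trans z0)// -(ler_sqr) ?nnegrE ?sqrtr_ge0//.
by rewrite sqr_sqrtr ?mulr_ge0 ?(le_trans z0)// expr2 ler_pM.
Qed.

Section translation_average.
Variables (kap p : R -> R).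
Hypotheses (ki : L1 kap) (pi : L1 p) (p0 : forall x, 0 <= p x) (p1 : \int[mu]_x p x = 1).
Let mk := measurable_L1 ki.
Let mP := measurable_primitive pi.

Lemma measurable_avg_increment f : measurable_fun setT f ->
  measurable_fun setT (avg_increment kap f).
Proof.
move=> mf; rewrite avg_increment.unlock.
apply: (@measurable_param_Rintegral _ _ _ _ _ mu (fun y x => kap x * increment f x y)).
by rewrite increment.unlock/=; mfun.
Qed.

Lemma L1_avg_increment : L1 (fun x => `|kap x| * `|x|) ->
  L1 (avg_increment kap (prim p)) /\
  \int[mu]_y avg_increment kap (prim p) y = - \int[mu]_x (x * kap x).
Proof.
move=> kxi.
have mid : measurable_fun setT (fun x : R => x) by [].
have [|||_ h1 h2] := @Rfubini_le _ _ _ _ R mu mu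
    (fun x => `|kap x| * `|x|) (fun x y => kap x * increment (prim p) x y).
- by rewrite increment.unlock/=; mfun.
- by [].
- move=> x; have [ii _] := L1_increment_primitive x pi.
  under eq_integral do rewrite normrM EFinM.
  rewrite integralZl//; last exact: L1_norm.
  by rewrite integral_norm_L1// -EFinM Rintegral_norm_increment.
- split; first by apply: eq_L1 h1 => y; rewrite avg_incrementE.
  have xki : L1 (fun x => x * kap x).
    by apply: le_L1 kxi => [|x]; [mfun|rewrite normrM mulrC].
  transitivity (\int[mu]_x \int[mu]_y (kap x * increment (prim p) x y)).
    by under eq_Rintegral do rewrite avg_incrementE; exact (esym h2).
  transitivity (\int[mu]_x (-1 * (x * kap x))); last by rewrite RintegralZl// mulN1r.
  apply: eq_Rintegral => x _; have [ii ie] := L1_increment_primitive x pi.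
  by rewrite RintegralZl// ie p1 mulr1 mulN1r mulrN mulrC.
Qed.

(* A product of increments of sizes x and s, and likewise an iterated increment, has an
   integral of order min(|x|, |s|) <= sqrt |x| * sqrt |s|. *)
Section sqrt_moment.
Hypothesis ksi : L1 (fun x => `|kap x| * Num.sqrt `|x|).
Let m := \int[mu]_x (`|kap x| * Num.sqrt `|x|).

(** The square is expanded one factor at a time: [b1] treats two plain increments, [b2] averages one
    of them, and a last use of Minkowski's inequality averages the other, with total bound
    [m * m]. *)
Lemma L1_sqr_avg_increment : L1 (fun y => avg_increment kap (prim p) y ^+ 2).
Proof.
set T := avg_increment kap (prim p).
have mT : measurable_fun setT T by exact: measurable_avg_increment.
have kpi y : L1 (fun x => kap x * increment (prim p) x y).
  apply: (L1_mul_bounded (C := 1)) => // [|x]; last exact: increment_primitive_le1.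
  by rewrite increment.unlock/=; mfun.
have b1 x s : (\int[mu]_y `|increment (prim p) x y * increment (prim p) s y|%:E <=
    (Num.sqrt `|x| * Num.sqrt `|s|)%:E)%E.
  have [xi _] := L1_increment_primitive x pi; have [si _] := L1_increment_primitive s pi.
  have xsi : L1 (fun y => increment (prim p) x y * increment (prim p) s y).
    apply: (L1_mul_bounded (C := 1)) => // [|y]; first exact: measurable_L1.
    exact: increment_primitive_le1.
  (* Bounding the second increment by 1 leaves the norm [|x|] of the first, and conversely leaves
     [|s|]. *)
  rewrite integral_norm_L1// lee_fin; apply: le_sqrtM; first exact: Rintegral_ge0.
  - rewrite -[leRHS](Rintegral_norm_increment pi p0 p1).
    apply: le_Rintegral => //; [exact: L1_norm|exact: L1_norm|].
    by move=> y _; rewrite normrM -[leRHS]mulr1 ler_wpM2l// increment_primitive_le1.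
  - rewrite -[leRHS](Rintegral_norm_increment pi p0 p1).
    apply: le_Rintegral => //; [exact: L1_norm|exact: L1_norm|].
    by move=> y _; rewrite normrM -[leRHS]mul1r ler_wpM2r// increment_primitive_le1.
have b2 x : (\int[mu]_y `|increment (prim p) x y * T y|%:E <=
    (Num.sqrt `|x| * m)%:E)%E.
  rewrite (_ : _ * m = \int[mu]_s (Num.sqrt `|x| * (`|kap s| * Num.sqrt `|s|))); last first.
    by rewrite RintegralZl.
  have := @Rminkowski_le (fun s => Num.sqrt `|x| * (`|kap s| * Num.sqrt `|s|))
    (fun s y => kap s * (increment (prim p) x y * increment (prim p) s y)).
  have -> : (\int[mu]_v `|\int[mu]_s (kap s * (increment (prim p) x v * increment (prim p) s v))|%:E =
      \int[mu]_y `|increment (prim p) x y * T y|%:E)%E.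
    apply: eq_integral => y _; rewrite /T avg_incrementE -RintegralZl//.
    by congr (`| _ |%:E); apply: eq_Rintegral => s _; rewrite mulrCA.
  apply; [by rewrite increment.unlock/=; mfun|exact: L1Z|].
  move=> s; rewrite mulrCA EFinM; apply: le_trans (lee_wpmul2l _ (b1 x s)); last by rewrite lee_fin.
  under eq_integral do rewrite normrM EFinM.
  rewrite ge0_integralZl//; apply/measurable_EFinP; rewrite increment.unlock/=; mfun.
apply: (@L1_le_fin _ (m * m)); first by mfun.
have := @Rminkowski_le (fun x => m * (`|kap x| * Num.sqrt `|x|))
  (fun x y => kap x * (increment (prim p) x y * T y)).
have -> : (\int[mu]_v `|\int[mu]_x (kap x * (increment (prim p) x v * T v))|%:E =
    \int[mu]_y `|T y ^+ 2|%:E)%E.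
  apply: eq_integral => y _; rewrite expr2 {2}/T avg_incrementE -RintegralZr//.
  by congr (`| _ |%:E); apply: eq_Rintegral => s _; rewrite mulrA.
rewrite (_ : \int[mu]_s _ = m * m); last by rewrite RintegralZl.
apply; [by rewrite increment.unlock/=; mfun|exact: L1Z|].
move=> x; rewrite mulrCA (mulrC m) EFinM; apply: le_trans (lee_wpmul2l _ (b2 x)); last by rewrite lee_fin.
under eq_integral do rewrite normrM EFinM.
rewrite ge0_integralZl//; apply/measurable_EFinP; rewrite increment.unlock/=; mfun.
Qed.

Lemma L1_avg_increment_twice : L1 (avg_increment kap (avg_increment kap (prim p))).
Proof.
set T := avg_increment kap (prim p).
have mT : measurable_fun setT T by exact: measurable_avg_increment.
have kpi y : L1 (fun x => kap x * increment (prim p) x y).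
  apply: (L1_mul_bounded (C := 1)) => // [|x]; last exact: increment_primitive_le1.
  by rewrite increment.unlock/=; mfun.
have b1 x s : (\int[mu]_y `|increment (increment (prim p) s) x y|%:E <=
    (2 * Num.sqrt `|x| * Num.sqrt `|s|)%:E)%E.
  have [xi _] := L1_increment_primitive x pi; have [si _] := L1_increment_primitive s pi.
  (* One more increment at most doubles the norm, and increments commute; so the double increment
     has norm at most [2 |s|] and at most [2 |x|]. *)
  have [sxi sx] := increment_norm_le x si; have [_ xs] := increment_norm_le s xi.
  rewrite !Rintegral_norm_increment// in sx xs.
  rewrite integral_norm_L1// lee_fin -mulrA mulrC -ler_pdivrMr//.
  apply: le_sqrtM; rewrite ?ler_pdivrMr 1?mulrC//; first by rewrite mulr_ge0 ?invr_ge0// Rintegral_ge0.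
  apply: le_trans xs; rewrite le_eqVlt; apply/orP; left; apply/eqP.
  by apply: eq_Rintegral => y _; rewrite !incrementE (addrAC y); congr (`| _ |); ring.
have b2 x : (\int[mu]_y `|increment T x y|%:E <= (2 * Num.sqrt `|x| * m)%:E)%E.
  rewrite (_ : _ * m = \int[mu]_s (2 * Num.sqrt `|x| * (`|kap s| * Num.sqrt `|s|))); last first.
    by rewrite RintegralZl.
  have := @Rminkowski_le (fun s => 2 * Num.sqrt `|x| * (`|kap s| * Num.sqrt `|s|))
    (fun s y => kap s * increment (increment (prim p) s) x y).
  have -> : (\int[mu]_v `|\int[mu]_s (kap s * increment (increment (prim p) s) x v)|%:E =
      \int[mu]_y `|increment T x y|%:E)%E.
    apply: eq_integral => y _; rewrite (incrementE T) /T !avg_incrementE -RintegralB//.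
    by congr (`| _ |%:E); apply: eq_Rintegral => s _; rewrite (incrementE (increment _ _)) mulrBr.
  apply; [by rewrite increment.unlock/=; mfun|exact: L1Z|].
  move=> s; rewrite mulrCA EFinM; apply: le_trans (lee_wpmul2l _ (b1 x s)); last by rewrite lee_fin.
  under eq_integral do rewrite normrM EFinM.
  rewrite ge0_integralZl//; apply/measurable_EFinP; rewrite increment.unlock/=; mfun.
have [|||_ h1 _] := @Rfubini_le _ _ _ _ R mu mu
    (fun x => 2 * m * (`|kap x| * Num.sqrt `|x|)) (fun x y => kap x * increment T x y).
- by rewrite increment.unlock/=; mfun.
- exact: L1Z.
- move=> x; rewrite (_ : 2 * m * _ = `|kap x| * (2 * Num.sqrt `|x| * m)); last by ring.
  rewrite EFinM; apply: le_trans (lee_wpmul2l _ (b2 x)); last by rewrite lee_fin.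
  under eq_integral do rewrite normrM EFinM.
  rewrite ge0_integralZl//; apply/measurable_EFinP; rewrite increment.unlock/=; mfun.
- by apply: eq_L1 h1 => y; rewrite [RHS]avg_incrementE.
Qed.

End sqrt_moment.
End translation_average.
End increments.

(** * Products, tails and autocorrelations of square integrable functions *)

Section square_integrable.
Context {R : realType}.
Notation mu := (@lebesgue_measure R).
Notation L1 f := (mu.-integrable setT (EFin \o f)).
Implicit Types u v : R -> R.

Lemma normM_le_sqr (x y : R) : `|x * y| <= x ^+ 2 + y ^+ 2.
Proof.
rewrite normrM -(real_normK (num_real x)) -(real_normK (num_real y)).
have := sqr_ge0 (`|x| - `|y|); have := sqr_ge0 (`|x| + `|y|); rewrite !expr2; nra.
Qed.

Lemma L1_mul u v : measurable_fun setT u -> measurable_fun setT v ->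
  L1 (fun x => u x ^+ 2) -> L1 (fun x => v x ^+ 2) -> L1 (fun x => u x * v x).
Proof.
move=> mf mg ui vi; apply: le_L1 (L1D ui vi); first by mfun.
by move=> x; exact: normM_le_sqr.
Qed.

Lemma Rintegral_norm_mul_le u v : measurable_fun setT u -> measurable_fun setT v ->
  L1 (fun x => u x ^+ 2) -> L1 (fun x => v x ^+ 2) ->
  \int[mu]_x `|u x * v x| <= \int[mu]_x u x ^+ 2 + \int[mu]_x v x ^+ 2.
Proof.
move=> mf mg ui vi; rewrite -RintegralD//; apply: le_Rintegral => //.
- exact/L1_norm/L1_mul.
- exact: L1D.
- by move=> x _; exact: normM_le_sqr.
Qed.

(** The Heaviside factor restricts to [|x| >= n / 2], the region that matters for two points at
    distance [n]. *)
Lemma cvg_tail_sqr u : measurable_fun setT u -> L1 (fun x => u x ^+ 2) ->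
  \int[mu]_x (u x ^+ 2 * heaviside (`|x| *+ 2 - n%:R)) @[n --> \oo] --> (0 : R).
Proof.
move=> mf ui; have mh := @measurable_heaviside R.
have ma : measurable_fun setT (fun x : R => `|x| *+ 2).
  by under eq_fun do rewrite mulr2n; mfun.
rewrite (_ : 0 = \int[mu]_x (cst 0 x)); last by rewrite /Rintegral integral0.
apply: (Rdominated_cvg (g := fun x => u x ^+ 2)) => //.
- by move=> n; mfun.
- move=> x; rewrite (_ : cst 0 x = u x ^+ 2 * 0); last by rewrite mulr0.
  by apply: cvgM; [exact: cvg_cst|exact: cvg_heaviside_subn].
- move=> n x; rewrite normrM ger0_norm ?sqr_ge0// -[leRHS]mulr1.
  by rewrite ler_wpM2l ?sqr_ge0// heaviside_bounded.
Qed.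

(* At each point one of y and y - n is at distance at least n / 2 from the origin. *)
Lemma cvg_autocorrelation u : measurable_fun setT u -> L1 (fun x => u x ^+ 2) ->
  \int[mu]_y (u y * u (y - n%:R)) @[n --> \oo] --> (0 : R).
Proof.
move=> mf ui; have mh := @measurable_heaviside R.
have ma : measurable_fun setT (fun x : R => `|x| *+ 2).
  by under eq_fun do rewrite mulr2n; mfun.
set N := \int[mu]_x u x ^+ 2.
have N0 : 0 <= N by apply: Rintegral_ge0 => x _; exact: sqr_ge0.
pose q n x : R := u x ^+ 2 * heaviside (`|x| *+ 2 - n%:R).
have qi n : L1 (q n).
  apply: (L1_mul_bounded (C := 1)) => // [|x]; [by mfun|exact: heaviside_bounded].
(* Weighted Young inequality: the large weight [lam] falls on the factor that lies in the tail, and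
   [lam^-1] on the other, which is controlled only by the full norm [N]. *)
have bound (lam : R) n : 0 < lam ->
    `|\int[mu]_y (u y * u (y - n%:R))| <= lam * \int[mu]_x q n x + lam^-1 * N.
  move=> lam0.
  have usi : L1 (fun y => u (y - n%:R) ^+ 2) by exact: (L1_shift (- n%:R) ui).
  have qsi : L1 (fun y => q n (y - n%:R)) by exact: (L1_shift (- n%:R) (qi n)).
  have uui : L1 (fun y => u y * u (y - n%:R)) by apply: L1_mul => //; mfun.
  have mq := measurable_L1 (qi n).
  apply: (le_trans (le_normr_Rintegral _ uui)) => //.
  have -> : lam * \int[mu]_x q n x + lam^-1 * N =
      \int[mu]_y ((lam * 2^-1) * (q n y + q n (y - n%:R)) +
                  (lam^-1 * 2^-1) * (u y ^+ 2 + u (y - n%:R) ^+ 2)).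
    rewrite RintegralD//; [|exact/L1Z/L1D|exact/L1Z/L1D].
    rewrite !RintegralZl//; [|exact: L1D|exact: L1D].
    rewrite !RintegralD// (Rintegral_shift (- n%:R))//.
    rewrite (Rintegral_shift (- n%:R) (f := fun y => u y ^+ 2)); last by mfun.
    by rewrite -/N; field; rewrite gt_eqF.
  apply: le_Rintegral => //; first exact: L1_norm.
    by apply: L1D; apply: L1Z; exact: L1D.
  move=> y _; rewrite normrM.
  have li0 : 0 < lam^-1 by rewrite invr_gt0.
  have amgm (s t : R) : `|s| * `|t| <= (lam * 2^-1) * s ^+ 2 + (lam^-1 * 2^-1) * t ^+ 2.
    rewrite -(real_normK (num_real s)) -(real_normK (num_real t)).
    have : 0 <= lam^-1 * (lam * `|s| - `|t|) ^+ 2 by rewrite mulr_ge0 ?sqr_ge0// ltW.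
    have -> : lam^-1 * (lam * `|s| - `|t|) ^+ 2 =
        lam * `|s| ^+ 2 - 2 * (`|s| * `|t|) + lam^-1 * `|t| ^+ 2.
      by field; rewrite gt_eqF.
    by move=> ?; lra.
  have q0 z : 0 <= q n z by rewrite mulr_ge0 ?sqr_ge0 ?heaviside_ge0.
  have : n%:R <= `|y| *+ 2 \/ n%:R <= `|y - n%:R| *+ 2.
    have [|/ltW] := leP n%:R (`|y| *+ 2); first by left.
    rewrite !mulr2n => yn; right; rewrite distrC.
    have := ler_norm (n%:R - y); have := ler_norm y; lra.
  case=> ny.
  - have -> : q n y = u y ^+ 2 by rewrite /q /heaviside subr_ge0 ny mulr1.
    apply: le_trans (amgm (u y) (u (y - n%:R))) _.
    rewrite !mulrDr; have := mulr_ge0 (mulr_ge0 (ltW lam0) (ltW (_ : 0 < 2^-1))) (q0 (y - n%:R)).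
    have := mulr_ge0 (mulr_ge0 (ltW li0) (ltW (_ : 0 < 2^-1))) (sqr_ge0 (u y)).
    by rewrite invr_gt0 ltr0n => /(_ isT) ? /(_ isT) ?; lra.
  - have -> : q n (y - n%:R) = u (y - n%:R) ^+ 2 by rewrite /q /heaviside subr_ge0 ny mulr1.
    rewrite mulrC; apply: le_trans (amgm (u (y - n%:R)) (u y)) _.
    rewrite !mulrDr; have := mulr_ge0 (mulr_ge0 (ltW lam0) (ltW (_ : 0 < 2^-1))) (q0 y).
    have := mulr_ge0 (mulr_ge0 (ltW li0) (ltW (_ : 0 < 2^-1))) (sqr_ge0 (u (y - n%:R))).
    by rewrite invr_gt0 ltr0n => /(_ isT) ? /(_ isT) ?; lra.
apply/cvgrPdist_le => e e0.
(* This makes [lam^-1 * N] at most [e / 2]; the added 1 keeps [lam] positive when [N = 0]. With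
   [lam] fixed, [n] is then taken large. *)
pose lam := (2 * (N + 1)) / e.
have lam0 : 0 < lam by rewrite divr_gt0// mulr_gt0// ltr_wpDl.
have e20 : 0 < e / 2 / lam by rewrite divr_gt0// divr_gt0// ltr0n.
have /cvgrPdist_le/(_ _ e20) := cvg_tail_sqr mf ui.
apply: filterS => n; rewrite !sub0r !normrN => qn.
apply: le_trans (bound lam n lam0) _.
have h1 : lam * \int[mu]_x q n x <= e / 2.
  by rewrite mulrC -ler_pdivlMr// (le_trans _ qn)// ler_norm.
have h2 : lam^-1 * N <= e / 2.
  rewrite /lam invf_div mulrAC ler_pdivrMr ?mulr_gt0// ?ltr_wpDl//.
  have -> : e / 2 * (2 * (N + 1)) = e * (N + 1) by field.
  by apply: ler_wpM2l; [exact: ltW|rewrite lerDl].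
by rewrite (splitr e); apply: lerD.
Qed.

End square_integrable.

(** * Smoothed densities *)

Definition bias_density {R : realType} (kap f : R -> R) (x : R) : R :=
  convolution kap f x - f x.

Definition sum_density {R : realType} (kap f : R -> R) (x : R) : R :=
  convolution kap f x + f x.

Section smoothing.
Context {R : realType}.
Notation mu := (@lebesgue_measure R).
Notation L1 f := (mu.-integrable setT (EFin \o f)).
Notation prim f := (convolution f heaviside).
Variables kap f : R -> R.
Hypotheses (ki : L1 kap) (k1 : \int[mu]_x kap x = 1)
  (ksym : forall x, kap (- x) = kap x) (k2 : L1 (fun x => kap x ^+ 2)).
Hypotheses (fi : L1 f) (f0 : forall x, 0 <= f x) (f1 : \int[mu]_x f x = 1)
  (f2 : L1 (fun x => f x ^+ 2)).

Let mk := measurable_L1 ki.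
Let mf := measurable_L1 fi.
Let eta := convolution kap f.
Let F := prim f.
Let p := cross_correlation f f.
Let Q := prim p.

Let mF : measurable_fun setT F. Proof. exact: measurable_primitive. Qed.

Let F_bounded y : `|F y| <= 1.
Proof. by rewrite ger0_norm ?primitive_ge0// -f1 primitive_le. Qed.

Let kfi y : L1 (fun s => kap s * f (y - s)).
Proof.
apply: L1_mul => //; first by mfun.
exact: (L1_reflect y f2).
Qed.

Lemma L1_smoothed : L1 eta.
Proof. exact: L1_convolution. Qed.

Lemma Rintegral_smoothed : \int[mu]_x eta x = 1.
Proof. by rewrite Rintegral_convolution// k1 f1 mulr1. Qed.

Let me : measurable_fun setT eta. Proof. exact: measurable_L1 L1_smoothed. Qed.

Let C := \int[mu]_x kap x ^+ 2 + \int[mu]_x f x ^+ 2.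

(** Both factors of the convolution are square integrable. Being bounded as well as integrable,
    [eta] has integrable products with [f] and with itself at every shift. *)
Lemma smoothed_bounded y : `|eta y| <= C.
Proof.
apply: (le_trans (le_normr_Rintegral _ (kfi y))) => //.
have mfy : measurable_fun setT (fun s : R => f (y - s)) by mfun.
apply: le_trans (Rintegral_norm_mul_le mk mfy k2 (L1_reflect y f2)) _.
by rewrite (Rintegral_reflect y (f := fun x => f x ^+ 2))//; mfun.
Qed.

Let ffi u : L1 (fun t => f t * f (t + u)).
Proof. by apply: L1_mul => //; [mfun|exact: (L1_shift u f2)]. Qed.

Let bounded_shift (b a : R -> R) u : L1 b -> measurable_fun setT a ->
  (forall x, `|a x| <= C) -> L1 (fun t => b t * a (t + u)).
Proof. by move=> bi ma aC; apply: (L1_mul_bounded (C := C)) => //; mfun. Qed.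

Let efi u : L1 (fun t => eta t * f (t + u)).
Proof.
apply: eq_L1 (L1_mul_bounded (L1_shift u fi) me smoothed_bounded) => t.
by rewrite mulrC.
Qed.

Let fei u : L1 (fun t => f t * eta (t + u)).
Proof. by apply: bounded_shift => //; exact: smoothed_bounded. Qed.

Let eei u : L1 (fun t => eta t * eta (t + u)).
Proof. by apply: bounded_shift => //; [exact: L1_smoothed|exact: smoothed_bounded]. Qed.

Lemma autocorrelation_even u : p (- u) = p u.
Proof. exact: cross_correlation_sym. Qed.

(** By the pairing formula, [eta \star f] at [v] is the [kap]-average of [p (s + v)]; it is even
    because [kap] and the autocorrelation [p] both are. *)
Lemma cross_correlation_smoothed_even u :
  cross_correlation eta f (- u) = cross_correlation eta f u.
Proof.
have E v : cross_correlation eta f v = \int[mu]_s (kap s * p (s + v)).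
  rewrite /cross_correlation (@convolution_pairing _ _ _ ki fi kfi (fun t => f (t + v)) (\int[mu]_x f x ^+ 2 + \int[mu]_x f x ^+ 2)).
  - by apply: eq_Rintegral => s _; congr (_ * _); apply: eq_Rintegral => y _; rewrite addrA.
  - by mfun.
  - move=> s; have i1 : L1 (fun y => f y * f (y + s + v)).
      by apply: eq_L1 (ffi (s + v)) => y; rewrite addrA.
    rewrite integral_norm_L1// lee_fin.
    have mfs : measurable_fun setT (fun y : R => f (y + s + v)) by mfun.
    have fsi : L1 (fun y => f (y + s + v) ^+ 2).
      by apply: eq_L1 (L1_shift (s + v) f2) => y; rewrite addrA.
    apply: le_trans (Rintegral_norm_mul_le mf mfs f2 fsi) _.
    rewrite lerD2l le_eqVlt; apply/orP; left; apply/eqP.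
    rewrite -(Rintegral_shift (s + v) (f := fun y => f y ^+ 2)); last by mfun.
    by apply: eq_Rintegral => y _; rewrite addrA.
have mp : measurable_fun setT p by exact: measurable_cross_correlation.
rewrite !E -[LHS]Rintegral_opp; last by mfun.
by apply: eq_Rintegral => s _; rewrite ksym -opprD autocorrelation_even.
Qed.

Let cfe u : cross_correlation f eta u = cross_correlation eta f u.
Proof. by rewrite -cross_correlation_sym// cross_correlation_smoothed_even. Qed.

Lemma xi_even : symmetric_about_origin (xi eta f).
Proof.
move=> u; rewrite /xi cross_correlation_smoothed_even.
by rewrite !(cross_correlation_sym u).
Qed.

Let g := bias_density kap f.
Let s := sum_density kap f.

Lemma L1_bias_density : L1 g. Proof. exact: L1B L1_smoothed fi. Qed.
Lemma L1_sum_density : L1 s. Proof. exact: L1D L1_smoothed fi. Qed.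

Lemma Rintegral_bias_density : \int[mu]_x g x = 0.
Proof.
by rewrite RintegralB ?Rintegral_smoothed ?f1 ?subrr//; exact: L1_smoothed.
Qed.

Let ggE u t : g t * g (t + u) =
  (eta t * eta (t + u) - eta t * f (t + u)) - (f t * eta (t + u) - f t * f (t + u)).
Proof. by rewrite /g /bias_density -/eta; ring. Qed.

Let gsE u t : g t * s (t + u) =
  (eta t * eta (t + u) + eta t * f (t + u)) - (f t * eta (t + u) + f t * f (t + u)).
Proof. by rewrite /g /s /bias_density /sum_density -/eta; ring. Qed.

Lemma L1_bias_bias u : L1 (fun t => g t * g (t + u)).
Proof.
apply: (@eq_L1 _ (fun t => _)); first by move=> t; rewrite ggE.
by apply: L1B; apply: L1B.
Qed.

Lemma L1_bias_sum u : L1 (fun t => g t * s (t + u)).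
Proof.
apply: (@eq_L1 _ (fun t => _)); first by move=> t; rewrite gsE.
by apply: L1B; apply: L1D.
Qed.

(** The expansion yields [eta \star f] and [f \star eta], which coincide by [cfe] and make up the
    coefficient 2. *)
Lemma xiE : xi eta f = cross_correlation g g.
Proof.
apply/funext => u; rewrite [RHS]/cross_correlation.
under eq_Rintegral do rewrite ggE.
rewrite RintegralB//; [|exact: L1B|exact: L1B].
rewrite !RintegralB//.
rewrite -/(cross_correlation eta eta u) -/(cross_correlation eta f u).
rewrite -/(cross_correlation f eta u) -/(cross_correlation f f u) cfe /xi; ring.
Qed.

(** The analogue of a difference of squares: by [cfe] the mixed terms now cancel. *)
Lemma cross_correlation_bias_sum u : cross_correlation g s u =
  cross_correlation eta eta u - cross_correlation f f u.
Proof.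
rewrite [LHS]/cross_correlation.
under eq_Rintegral do rewrite gsE.
rewrite RintegralB//; [|exact: L1D|exact: L1D].
rewrite !RintegralD//.
rewrite -/(cross_correlation eta eta u) -/(cross_correlation eta f u).
rewrite -/(cross_correlation f eta u) -/(cross_correlation f f u) cfe; ring.
Qed.

Lemma L1_xi : L1 (xi eta f).
Proof. by rewrite xiE; apply: L1_cross_correlation; exact: L1_bias_density. Qed.

Lemma Rintegral_xi : \int[mu]_u xi eta f u = 0.
Proof.
rewrite xiE Rintegral_cross_correlation ?Rintegral_bias_density ?mul0r//;
  try exact: L1_bias_density; exact: L1_bias_bias.
Qed.

Let kFi y : L1 (fun x => kap x * F (y - x)).
Proof. by apply: (L1_mul_bounded (C := 1)) => //; mfun. Qed.

Lemma avg_increment_convolution (P : R -> R) (B y : R) : measurable_fun setT P ->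
  (forall x, `|P x| <= B) -> avg_increment kap P y = convolution kap P y - P y.
Proof.
move=> mP PB; rewrite avg_incrementE.
have kPi : L1 (fun x => kap x * P (y - x)).
  by apply: (L1_mul_bounded (C := B)) => //; mfun.
under eq_Rintegral do rewrite incrementE mulrBr.
rewrite RintegralB//; last by apply: (L1_mul_bounded (C := B)).
by rewrite RintegralZr// k1 mul1r.
Qed.

Lemma primitive_bias_density y : prim g y = avg_increment kap F y.
Proof.
rewrite (avg_increment_convolution _ mF F_bounded) /g /bias_density primitiveB//; last exact: L1_smoothed.
by rewrite primitive_convolution.
Qed.

Section bounded.
Variables (P : R -> R) (B : R).
Hypotheses (mP : measurable_fun setT P) (PB : forall x, `|P x| <= B).

Let mfP : measurable_fun setT (cross_correlation f P).
Proof. exact: measurable_cross_correlation. Qed.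

Let fP_bounded v : `|cross_correlation f P v| <= B.
Proof.
have := @Rintegral_norm_mul_bounded R f (fun t => P (t + v)) B fi.
have -> : \int[mu]_x `|f x| = 1.
  by rewrite -f1; apply: eq_Rintegral => x _; rewrite ger0_norm.
by rewrite mulr1; apply => //; mfun.
Qed.

(** Taking [kap] out of the first argument of a cross-correlation reverses the sign of its shift,
    and evenness of [kap] restores it. *)
Lemma cross_correlation_bias v :
  cross_correlation g P v = avg_increment kap (cross_correlation f P) v.
Proof.
rewrite (avg_increment_convolution _ mfP fP_bounded).
have ePi : L1 (fun t => eta t * P (t + v)).
  by apply: (L1_mul_bounded (C := B)) => //; [exact: L1_smoothed|mfun].
have fPi : L1 (fun t => f t * P (t + v)).
  by apply: (L1_mul_bounded (C := B)) => //; mfun.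
rewrite {1}/cross_correlation /g /bias_density.
under eq_Rintegral do rewrite mulrBl.
rewrite RintegralB//; congr (_ - _).
have mPv : measurable_fun setT (fun t : R => P (t + v)) by mfun.
transitivity (\int[mu]_s (kap s * \int[mu]_y (f y * P (y + s + v)))).
  exact (@convolution_pairing_bounded _ _ _ ki fi kfi (fun t => P (t + v)) B mPv (fun x => PB _)).
rewrite -Rintegral_opp; last first.
  have mq : measurable_fun setT (fun q : R => \int[mu]_y (f y * P (y + q + v))).
    apply: (@measurable_param_Rintegral _ _ _ _ _ mu (fun q y => f y * P (y + q + v))) => /=.
    by mfun.
  by mfun.
apply: eq_Rintegral => s' _; rewrite ksym; congr (_ * _).
by apply: eq_Rintegral => y _; congr (_ * P _); ring.
Qed.

Lemma cross_correlation_avg_increment (b : R -> R) v : L1 b ->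
  cross_correlation b (avg_increment kap P) v =
  avg_increment kap (cross_correlation b P) v.
Proof.
move=> bi; have mb := measurable_L1 bi.
rewrite /cross_correlation; under eq_Rintegral do rewrite avg_incrementE.
transitivity (\int[mu]_t \int[mu]_x (b t * kap x * increment P x (t + v))).
  apply: eq_Rintegral => t _; rewrite -RintegralZl//.
    by apply: eq_Rintegral => x _; rewrite mulrA.
  apply: (L1_mul_bounded (C := B + B)) => // [|x].
    by rewrite increment.unlock/=; mfun.
  by rewrite incrementE (le_trans (ler_normB _ _))// lerD.
have [||_ _ ->] := @Rfubini_prod _ _ _ _ R mu mu b kap (fun t x => increment P x (t + v)) (B + B) bi ki.
- by rewrite increment.unlock/=; mfun.
- by move=> t x; rewrite incrementE (le_trans (ler_normB _ _))// lerD.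
rewrite avg_incrementE; apply: eq_Rintegral => x _.
have bP y : L1 (fun t => b t * P (t + y)).
  by apply: (L1_mul_bounded (C := B)) => //; mfun.
rewrite [in RHS]incrementE -RintegralB// -RintegralZl//; last exact: L1B.
by apply: eq_Rintegral => t _; rewrite incrementE addrA mulrBr; ring.
Qed.

End bounded.

Let pi : L1 p. Proof. exact: L1_cross_correlation. Qed.
Let p0 u : 0 <= p u.
Proof. by apply: Rintegral_ge0 => t _; rewrite mulr_ge0. Qed.
Let p1 : \int[mu]_u p u = 1.
Proof. by rewrite Rintegral_cross_correlation// f1 mulr1. Qed.

(** The primitive falls on the second copy of [g] and turns it into an averaged increment of [F];
    the first copy contributes another averaged increment, and what remains is [f \star F], that is
    [Q]. *)
Lemma primitive_xi v :
  prim (xi eta f) v = avg_increment kap (avg_increment kap Q) v.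
Proof.
rewrite xiE primitive_cross_correlation; try exact: L1_bias_density; last exact: L1_bias_bias.
rewrite (_ : prim g = avg_increment kap F); last by apply/funext => y; exact: primitive_bias_density.
rewrite (cross_correlation_avg_increment mF F_bounded); last exact: L1_bias_density.
congr (avg_increment _ _ _); apply/funext => y.
rewrite (cross_correlation_bias mF F_bounded); congr (avg_increment _ _ _).
by apply/funext => z; rewrite -primitive_cross_correlation.
Qed.

Let G := avg_increment kap F.

Let primG : prim g = G.
Proof. by apply/funext => y; exact: primitive_bias_density. Qed.

Let mG : measurable_fun setT G.
Proof. by rewrite -primG; apply: measurable_primitive; exact: L1_bias_density. Qed.

Lemma antiderivative2_xi : L1 (fun x => `|kap x| * Num.sqrt `|x|) ->
  L1 (fun y => G y ^+ 2) /\
  antiderivative2 (xi eta f) 0 = (- \int[mu]_y G y ^+ 2)%:E.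
Proof.
move=> ksi.
have G2 : L1 (fun y => G y ^+ 2) by exact: L1_sqr_avg_increment.
split=> //; rewrite xiE antiderivative2_cross_correlation; first 1 last.
- exact: L1_bias_density.
- exact: L1_bias_density.
- exact: L1_bias_bias.
- exact: Rintegral_bias_density.
- rewrite -xiE (_ : prim _ = avg_increment kap (avg_increment kap Q)).
    exact: L1_avg_increment_twice.
  by apply/funext => v; exact: primitive_xi.
- by apply: eq_L1 G2 => y; rewrite primG expr2.
- move=> n; rewrite primG; apply: L1_mul => //; first by mfun.
  exact: (L1_shift (- n%:R) G2).
- by rewrite primG; exact: cvg_autocorrelation.
- by rewrite primG; congr ((- _)%:E); apply: eq_Rintegral => y _; rewrite expr2.
Qed.

(** [prim s] tends to 2 at [+oo], so integrability has to come from [G]: the primitive of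
    [g \star s] is [- G \star s], a correlation of integrable functions, and the boundary term
    vanishes by dominated convergence. *)
Lemma antiderivative2_bias_sum : L1 G ->
  L1 (fun y => G y * prim s y) /\
  L1 (prim (cross_correlation g s)) /\
  antiderivative2 (cross_correlation g s) 0 = (- \int[mu]_y (G y * prim s y))%:E.
Proof.
move=> Gi.
have si : L1 s := L1_sum_density.
have gi : L1 g := L1_bias_density.
have mS : measurable_fun setT (prim s) by exact: measurable_primitive.
have GSi n : L1 (fun y => G y * prim s (y - n)).
  apply: (L1_mul_bounded (C := \int[mu]_x `|s x|)) => // [|x]; first by mfun.
  exact: primitive_bounded.
have GS : L1 (fun y => G y * prim s y).
  by apply: eq_L1 (GSi 0) => y; rewrite subr0.
have Ai : L1 (prim (cross_correlation g s)).
  apply: (@eq_L1 _ (fun v => - cross_correlation G s v)).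
    move=> v; rewrite primitive_cross_correlation//; last exact: L1_bias_sum.
    by rewrite cross_correlation_primitiveC ?Rintegral_bias_density// primG.
  by apply: L1N; exact: L1_cross_correlation.
split=> //; split=> //.
rewrite antiderivative2_cross_correlation ?primG//.
- exact: L1_bias_sum.
- exact: Rintegral_bias_density.
- rewrite (_ : 0 = \int[mu]_x (cst 0 x)); last by rewrite /Rintegral integral0.
  apply: (Rdominated_cvg (g := fun x => `|G x| * \int[mu]_x `|s x|)).
  + by move=> n; exact: measurable_L1.
  + by [].
  + move=> x; rewrite (_ : cst 0 x = G x * 0); last by rewrite mulr0.
    by apply: cvgM; [exact: cvg_cst|exact: cvg_primitive_subn].
  + by move=> n x; rewrite normrM ler_wpM2l// primitive_bounded.
  + apply: (@eq_L1 _ (fun x => (\int[mu]_x `|s x|) * `|G x|)); first by move=> x; rewrite mulrC.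
    exact/L1Z/L1_norm.
Qed.

End smoothing.

(** * Kernels *)

Section kernels.
Context {R : realType}.
Notation mu := (@lebesgue_measure R).
Notation L1 f := (mu.-integrable setT (EFin \o f)).
Notation prim f := (convolution f heaviside).

(** The derivative of [- t^(-1/2)], whence the factor 1/2. The exponent is that of
    [sqrt t / t^2]. *)
Let tail (t : R) : R := 2^-1 * t `^ (- (3 / 2)).

Let mtail : measurable_fun setT tail.
Proof. by have h := @measurable_powR R (- (3 / 2)); rewrite /tail; mfun. Qed.

Let L1_tail : L1 (fun t => tail t * heaviside (t - 1)).
Proof.
have mh := @measurable_heaviside R.
pose Phi : R -> R := - (@powR R ^~ (- 2^-1)).
have dPhi (t : R) : 0 < t -> is_derive t 1 Phi (tail t).
  move=> t0; rewrite /tail (_ : 2^-1 * _ = - (- 2^-1 * t `^ (- 2^-1 - 1))).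
    exact/is_deriveN/is_derive1_powR.
  by rewrite mulNr opprK; congr (_ * _ `^ _); field.
have dtail (t : R) : 0 < t -> derivable tail t 1.
  move=> t0; apply: derivableM; first exact: derivable_cst.
  by apply: ex_derive; exact: is_derive1_powR.
have tail0 (t : R) : 0 <= tail t by rewrite mulr_ge0 ?powR_ge0.
have lim0 : Phi t @[t --> +oo] --> (0 : R).
  rewrite -oppr0; apply: cvgN.
  suff h : (t `^ 2^-1)^-1 @[t --> +oo] --> (0 : R).
    apply: cvg_trans h; apply: near_eq_cvg; near=> t; by rewrite powRN.
  apply/gtr0_cvgV0; first by near=> t; apply: powR_gt0; near: t; exact: nbhs_pinfty_gt.
  apply/cvgryPge => A; near=> t.
  have t0 : 0 <= t by near: t; exact: nbhs_pinfty_ge.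
  rewrite powR12_sqrt//; apply: (le_trans (ler_norm _)).
  rewrite -sqrtr_sqr ler_sqrt//; near: t; exact: nbhs_pinfty_ge.
apply/integrableP; split; first by apply/measurable_EFinP; mfun.
rewrite (_ : (\int[mu]_t _)%E = (\int[mu]_(t in `[1%R, +oo[%classic) (tail t)%:E)%E).
  rewrite (@ge0_continuous_FTC2y _ tail Phi 1 0) ?ltry//.
  - apply: derivable_within_continuous => t; rewrite in_itv/= andbT => t1.
    by apply: dtail; rewrite (lt_le_trans _ t1).
  - move=> t t1; have t0 : 0 < t by rewrite (lt_trans _ t1).
    exact: (@ex_derive _ _ _ _ _ _ _ (dPhi t t0)).
  - apply: cvg_at_right_filter; apply: differentiable_continuous.
    by apply/derivable1_diffP; exact: (@ex_derive _ _ _ _ _ _ _ (dPhi 1 ltr01)).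
  - move=> t; rewrite in_itv/= andbT => t1.
    have t0 : 0 < t by rewrite (lt_trans _ t1).
    by rewrite derive1E (@derive_val _ _ _ _ _ _ _ (dPhi t t0)).
rewrite [RHS]integral_mkcond; apply: eq_integral => t _.
rewrite patchE mem_setE in_itv/= andbT /heaviside subr_ge0.
by case: ifPn => _; rewrite ?mulr1 ?mulr0/= ger0_norm.
Unshelve. all: by end_near. Qed.

Section kernel.
Variable k : R -> R.
Hypotheses (ki : L1 k) (ksym : forall x, k (- x) = k x).
Let mk := measurable_L1 ki.

Lemma L1_sqrt_moment : t ^+ 2 * k t @[t --> +oo] --> 0 ->
  L1 (fun x => `|k x| * Num.sqrt `|x|).
Proof.
move=> klim; have mh := @measurable_heaviside R.
have msq : measurable_fun setT (@Num.sqrt R).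
  by apply: continuous_measurable_fun; exact: sqrt_continuous.
have [T [T1 kT]] : exists T, 1 <= T /\ forall t, T <= t -> `|k t| * Num.sqrt t <= 2 * tail t.
  have /cvgrPdist_le/(_ _ ltr01) := klim.
  move=> [M [_ kM]].
  (* The bound from the limit holds for [t > M] strictly, hence [M + 1]; the 1 keeps [t] positive
     and inside the range where the truncated [tail] is not cut off. *)
  exists (Num.max 1 (M + 1)); split; first by rewrite le_max lexx.
  move=> t; rewrite ge_max => /andP[t1 tM].
  have t0 : 0 < t by rewrite (lt_le_trans _ t1).
  have := kM t; rewrite sub0r normrN => /(_ _)/=; rewrite (lt_le_trans _ tM) ?ltrDl// => /(_ isT).
  rewrite normrM ger0_norm ?sqr_ge0// => kt.
  have -> : 2 * tail t = t `^ (- (3 / 2)) by rewrite /tail mulrA divff// mul1r.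
  have -> : Num.sqrt t = t `^ (- (3 / 2)) * t ^+ 2.
    rewrite -powR_mulrn ?ltW// -powRD; last by apply/implyP => _; rewrite gt_eqF.
    by rewrite -powR12_sqrt ?ltW//; congr (_ `^ _); field.
  rewrite mulrCA -[leRHS]mulr1 ler_wpM2l ?powR_ge0// mulrC; exact: kt.
have mk' := mk.
(* For [|x| <= T] the root is at most [sqrt T]; beyond, one of the two reflected tails takes over,
   by evenness of [k] on the negative side. *)
apply: (@le_L1 _ _ (fun x => Num.sqrt T * `|k x| +
   2 * (tail x * heaviside (x - 1) + tail (- x) * heaviside (- x - 1)))).
- by mfun.
- move=> x; have q0 (y : R) : 0 <= tail y * heaviside (y - 1).
    by rewrite !mulr_ge0 ?powR_ge0 ?heaviside_ge0.
  rewrite normrM normr_id ger0_norm ?sqrtr_ge0//.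
  have big (y : R) : T <= y -> `|k y| * Num.sqrt y <= 2 * (tail y * heaviside (y - 1)).
    by move=> Ty; rewrite /heaviside subr_ge0 (le_trans T1 Ty) mulr1; exact: kT.
  have [xT|xT] := leP `|x| T.
    rewrite mulrC -[leLHS]addr0 lerD//; last by rewrite mulr_ge0// addr_ge0.
    by rewrite ler_wpM2r// ler_sqrt// (le_trans _ T1).
  rewrite -[leLHS]add0r; apply: lerD; first by rewrite mulr_ge0 ?sqrtr_ge0.
  have [x0|x0] := leP 0 x.
    move: xT; rewrite ger0_norm// => /ltW xT.
    by rewrite (le_trans (big _ xT))// ler_wpM2l// lerDl.
  move: xT; rewrite ltr0_norm// => /ltW xT.
  by rewrite -(ksym x) (le_trans (big _ xT))// ler_wpM2l// lerDr.
- apply: L1D; first exact/L1Z/L1_norm.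
  by apply: L1Z; apply: L1D; [exact: L1_tail|exact: (L1_opp L1_tail)].
Qed.

(** Far to the right the primitive is at least 1/2, so [|x k(x)|] is at most twice the given
    integrand. On the left the primitive tends to 0 and the bound is carried over by evenness of
    [k]. *)
Lemma L1_first_moment : \int[mu]_x k x = 1 -> L1 (fun x => x * prim k x * k x) ->
  L1 (fun x => `|k x| * `|x|).
Proof.
move=> k1 psii; have mk' := mk; have mh := @measurable_heaviside R.
have mp := measurable_primitive ki.
have nki := L1_norm ki.
(* The kernel may change sign, so its primitive need not be monotone; the tail of [|k|] beyond [N]
   is made at most 1/2 instead. *)
have [N kN] : exists N : nat, \int[mu]_x `|k x| - 2^-1 <= prim (fun x => `|k x|) N%:R.
  have /cvgrPdist_le/(_ (2^-1) _) := cvg_primitive_addn 0 nki.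
  rewrite invr_gt0 ltr0n => /(_ isT)[N _ /(_ N (leqnn N))] /= h; exists N.
  by rewrite add0r in h; move: h; rewrite ler_norml => /andP[_]; lra.
have half x : N%:R <= x -> 2^-1 <= prim k x.
  move=> Nx; have := le_primitive nki (fun x => normr_ge0 _) Nx.
  have kci : L1 (fun t => k t * (1 - heaviside (x - t))).
    apply: (L1_mul_bounded (C := 1)) => // [|t]; first by mfun.
    by rewrite ger0_norm ?subr_ge0 ?heaviside_le1// gerBl heaviside_ge0.
  have E (u : R -> R) : L1 u -> \int[mu]_t (u t * (1 - heaviside (x - t))) = \int[mu]_t u t - prim u x.
    move=> ui; rewrite /convolution -(RintegralB measurableT ui (L1_heaviside x ui)).
    by apply: eq_Rintegral => t _; rewrite mulrBr mulr1.
  have := le_normr_Rintegral measurableT kci.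
  under [leRHS]eq_Rintegral do rewrite normrM (@ger0_norm _ (1 - _)) ?subr_ge0 ?heaviside_le1//.
  rewrite !E// k1 ler_norml => /andP[_]; lra.
apply: (@le_L1 _ _ (fun x => N%:R * `|k x| +
   2 * (`|x * prim k x * k x| + `|- x * prim k (- x) * k (- x)|))).
- by mfun.
- move=> x; rewrite normrM !normr_id.
  have big (y : R) : N%:R <= y -> `|k y| * y <= 2 * `|y * prim k y * k y|.
    move=> Ny; have y0 : 0 <= y by rewrite (le_trans _ Ny).
    have h := half _ Ny; rewrite !normrM (ger0_norm y0) (@ger0_norm _ (prim k y)); last lra.
    have := mulr_ge0 (normr_ge0 (k y)) y0; nra.
  have [xN|xN] := leP `|x| N%:R.
    by rewrite mulrC -[leLHS]addr0 lerD// ?ler_wpM2r// mulr_ge0// addr_ge0.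
  rewrite -[leLHS]add0r; apply: lerD; first by rewrite mulr_ge0.
  have [x0|x0] := leP 0 x.
    move: xN; rewrite ger0_norm// => /ltW xN.
    by rewrite (le_trans (big _ xN))// ler_wpM2l// lerDl.
  move: xN; rewrite ltr0_norm// => /ltW xN.
  by rewrite -{1}(ksym x) (le_trans (big _ xN))// ler_wpM2l// lerDr.
- apply: L1D; first exact/L1Z/L1_norm.
  by apply: L1Z; apply: L1D; [exact: L1_norm|exact: (L1_norm (L1_opp psii))].
Qed.

End kernel.

Lemma heaviside_compl_bounded (t : R) : `|1 - heaviside t| <= 1.
Proof.
by rewrite ger0_norm ?subr_ge0 ?heaviside_le1// gerBl heaviside_ge0.
Qed.

Lemma L1_heaviside_compl (a : R -> R) y : L1 a ->
  L1 (fun x => a x * (1 - heaviside (x - y))) /\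
  \int[mu]_x (a x * (1 - heaviside (x - y))) = prim a y.
Proof.
move=> ai; have mh := @measurable_heaviside R; have ma := measurable_L1 ai.
split.
  by apply: (L1_mul_bounded (C := 1)) => // [|x]; [mfun|exact: heaviside_compl_bounded].
have hi : L1 (fun x => a x * heaviside (x - y)).
  by apply: (L1_mul_bounded (C := 1)) => // [|x]; [mfun|exact: heaviside_bounded].
transitivity (\int[mu]_x a x - \int[mu]_x (a x * heaviside (x - y))).
  rewrite -(RintegralB measurableT ai hi).
  by apply: eq_Rintegral => x _; rewrite mulrBr mulr1.
by rewrite primitive_compl// opprB addrCA subrr addr0.
Qed.

(* Split the square {x <= z, y <= z} along its diagonal. *)
Let heaviside_split (x y z : R) : heaviside (z - x) * heaviside (z - y) =
  heaviside (z - x) * heaviside (x - y) + heaviside (z - y) * (1 - heaviside (x - y)).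
Proof.
rewrite /heaviside !subr_ge0; case: (leP y x) => yx.
  rewrite subrr mulr0 addr0 mulr1; case: (leP x z) => xz; rewrite ?mul0r// mul1r.
  by rewrite (le_trans yx xz).
rewrite subr0 mulr0 add0r mulr1; case: (leP y z) => yz; rewrite ?mulr0// mulr1.
by rewrite (ltW (lt_le_trans yx yz)).
Qed.

(** The chain rule for an integrable [a]: the square is a double integral of [a x * a y], and each
    triangle contributes the integral of [D], the second one after an exchange of the variables. *)
Lemma primitive_sqr (a : R -> R) z : L1 a ->
  prim a z ^+ 2 = prim (fun x => 2 * prim a x * a x) z.
Proof.
move=> ai; have ma := measurable_L1 ai; have mh := @measurable_heaviside R.
have ahi := L1_heaviside z ai.
pose e1 (x y : R) : R := heaviside (z - x) * heaviside (x - y).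
pose e2 (x y : R) : R := heaviside (z - y) * (1 - heaviside (x - y)).
have b1 x y : `|e1 x y| <= 1.
  by rewrite normrM mulr_ile1// heaviside_bounded.
have b2 x y : `|e2 x y| <= 1.
  by rewrite normrM mulr_ile1// ?heaviside_bounded ?heaviside_compl_bounded.
have m1 : measurable_fun setT (fun q : R * R => e1 q.1 q.2) by rewrite /e1; mfun.
have m2 : measurable_fun setT (fun q : R * R => e2 q.1 q.2) by rewrite /e2; mfun.
have [i1 _ _] := @Rfubini_prod _ _ _ _ R mu mu a a e1 1 ai ai m1 b1.
have [i2 _ s2] := @Rfubini_prod _ _ _ _ R mu mu a a e2 1 ai ai m2 b2.
pose D x := prim a x * (a x * heaviside (z - x)).
have Di : L1 D.
  apply: (@eq_L1 _ (fun x => a x * heaviside (z - x) * prim a x)).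
    by move=> x; rewrite /D mulrC.
  exact: (L1_mul_bounded ahi (measurable_primitive ai) (fun x => primitive_bounded x ai)).
have E1 : \int[mu]_x \int[mu]_y (a x * a y * e1 x y) = \int[mu]_x D x.
  apply: eq_Rintegral => x _.
  transitivity (\int[mu]_y ((a x * heaviside (z - x)) * (a y * heaviside (x - y)))).
    by apply: eq_Rintegral => y _; rewrite /e1; ring.
  by rewrite (RintegralZl _ measurableT (L1_heaviside x ai)) /D mulrC.
have E2 : \int[mu]_x \int[mu]_y (a x * a y * e2 x y) = \int[mu]_x D x.
  apply: (etrans s2); apply: eq_Rintegral => y _.
  have [hi hE] := L1_heaviside_compl y ai.
  transitivity (\int[mu]_x ((a y * heaviside (z - y)) * (a x * (1 - heaviside (x - y))))).
    by apply: eq_Rintegral => x _; rewrite /e2; ring.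
  by rewrite (RintegralZl _ measurableT hi) hE /D mulrC.
have e12i x (e : R -> R -> R) : measurable_fun setT (fun q : R * R => e q.1 q.2) ->
    (forall x y, `|e x y| <= 1) -> L1 (fun y => a x * a y * e x y).
  move=> me eb.
  exact: (L1_mul_bounded (L1Z (a x) ai) (measurable_section2 (h := e) me x) (eb x)).
transitivity (\int[mu]_x (\int[mu]_y (a x * a y * e1 x y) + \int[mu]_y (a x * a y * e2 x y))).
  rewrite expr2 {1}/convolution -(RintegralZr _ measurableT ahi).
  apply: eq_Rintegral => x _.
  rewrite -(RintegralD measurableT (e12i x e1 m1 b1) (e12i x e2 m2 b2)).
  rewrite -(RintegralZl _ measurableT ahi); apply: eq_Rintegral => y _.
  by rewrite -mulrDr -heaviside_split; ring.
rewrite (RintegralD measurableT i1 i2) E1 E2.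
transitivity (\int[mu]_x (2 * D x)).
  by rewrite (RintegralZl _ measurableT Di) mulr_natl mulr2n.
transitivity (\int[mu]_x ((2 * prim a x * a x) * heaviside (z - x))); last by [].
by apply: eq_Rintegral => x _; rewrite /D; ring.
Qed.

End kernels.

(** * Integral of the variance *)

Section rescaled_kernel.
Context {R : realType}.
Notation mu := (@lebesgue_measure R).
Notation L1 f := (mu.-integrable setT (EFin \o f)).
Notation prim f := (convolution f heaviside).
Variables (k : R -> R) (h : R).
Hypotheses (ki : L1 k) (h0 : 0 < h).
Let mk := measurable_L1 ki.
Let kap := rescaled k h.
Let h_neq0 : h != 0. Proof. by rewrite gt_eqF. Qed.

Lemma integrated_kernelE z : integrated_kernel k z = prim k z.
Proof.
by rewrite /integrated_kernel {1}/Rintegral integral_heaviside.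
Qed.

Lemma L1_rescaled : L1 kap.
Proof.
apply: eq_L1 (L1Z h^-1 (L1_scale h0 ki)) => x.
by rewrite /kap /rescaled mulrC.
Qed.

Lemma Rintegral_rescaled : \int[mu]_x kap x = \int[mu]_x k x.
Proof.
transitivity (\int[mu]_x (h^-1 * k (x / h))).
  by apply: eq_Rintegral => x _; rewrite /kap /rescaled mulrC.
rewrite (RintegralZl _ measurableT (L1_scale h0 ki)) Rintegral_scale//.
by rewrite mulrA mulVf// mul1r.
Qed.

Lemma rescaled_even : symmetric_about_origin k -> forall x, kap (- x) = kap x.
Proof. by move=> ksym x; rewrite /kap /rescaled mulNr ksym. Qed.

Lemma L1_sqr_rescaled : L1 (fun x => k x ^+ 2) -> L1 (fun x => kap x ^+ 2).
Proof.
move=> k2; apply: eq_L1 (L1Z (h^-1 ^+ 2) (L1_scale h0 k2)) => x.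
by rewrite /kap /rescaled exprMn mulrC.
Qed.

Lemma L1_sqrt_moment_rescaled : L1 (fun x => `|k x| * Num.sqrt `|x|) ->
  L1 (fun x => `|kap x| * Num.sqrt `|x|).
Proof.
move=> ksi; apply: eq_L1 (L1Z (Num.sqrt h / h) (L1_scale h0 ksi)) => x.
rewrite /kap /rescaled !normrM normfV (gtr0_norm h0) sqrtrM// sqrtrV ?ltW//.
have sh0 : Num.sqrt h != 0 by rewrite gt_eqF ?sqrtr_gt0.
by field; rewrite sh0 h_neq0.
Qed.

Lemma L1_first_moment_rescaled : L1 (fun x => `|k x| * `|x|) ->
  L1 (fun x => `|kap x| * `|x|).
Proof.
move=> ksi; apply: eq_L1 (L1_scale h0 ksi) => x.
rewrite /kap /rescaled !normrM normfV (gtr0_norm h0).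
by field.
Qed.

Lemma primitive_rescaled z : prim kap z = prim k (z / h).
Proof.
have mh := @measurable_heaviside R.
transitivity (\int[mu]_x (h^-1 * (k (x / h) * heaviside (z / h - x / h)))).
  apply: eq_Rintegral => x _; rewrite /kap /rescaled mulrA (mulrC h^-1); congr (_ * _).
  by rewrite /heaviside !subr_ge0 ler_pM2r ?invr_gt0.
have hi := L1_heaviside (z / h) ki.
rewrite (RintegralZl _ measurableT (L1_scale h0 hi)).
rewrite (Rintegral_scale (f := fun x => k x * heaviside (z / h - x)))//; last exact: measurable_L1.
by rewrite mulrA mulVf// mul1r.
Qed.

(** The right-hand side is the first moment of the derivative of [K(x/h)^2]; its integrand is
    [2 * psi_integrand k (x / h)], and the dilation produces the factor [h]. *)
Lemma psi_rescaled : L1 (psi_integrand k) ->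
  (h%:E * psi k)%E = (\int[mu]_x (x * (2 * prim kap x * kap x)))%:E.
Proof.
move=> psii; rewrite /psi.
have -> : (\int[mu]_x (psi_integrand k x)%:E = (\int[mu]_x psi_integrand k x)%:E)%E.
  by rewrite /Rintegral fineK//; exact: integrable_fin_num.
rewrite -!EFinM; congr EFin.
transitivity (\int[mu]_x (2 * psi_integrand k (x / h))).
  by rewrite (RintegralZl _ measurableT (L1_scale h0 psii)) Rintegral_scale//;
    [rewrite mulrCA|exact: measurable_L1].
apply: eq_Rintegral => x _.
by rewrite primitive_rescaled /psi_integrand integrated_kernelE /kap /rescaled; ring.
Qed.

End rescaled_kernel.

Section variance_integral.
Context {R : realType}.
Notation mu := (@lebesgue_measure R).
Notation L1 f := (mu.-integrable setT (EFin \o f)).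
Notation prim f := (convolution f heaviside).

(** Covers an infinite integral of [a]. The negative part of [a + b] is at most [|b|], hence of
    finite integral, while [a] is at most the positive part plus [|b|], so that the positive part
    must have infinite integral. *)
Lemma ge0_integralD_L1 (a b : R -> R) : measurable_fun setT a ->
  (forall x, 0 <= a x) -> L1 b ->
  (\int[mu]_x (a x + b x)%:E = \int[mu]_x (a x)%:E + \int[mu]_x (b x)%:E)%E.
Proof.
move=> ma a0 bi.
have [ai|] := boolP (\int[mu]_x (a x)%:E < +oo)%E.
  have ai' : L1 a.
    apply/integrableP; split; first exact/measurable_EFinP.
    by under eq_integral do rewrite gee0_abs ?lee_fin//.
  exact: (integralD_EFin measurableT ai' bi).
rewrite -leNgt leye_eq => /eqP ay.
have mb := measurable_L1 bi.
have -> : (\int[mu]_x (a x)%:E + \int[mu]_x (b x)%:E = +oo)%E.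
  by rewrite ay addye// gt_eqF// ltNye_eq; rewrite (integrable_fin_num _ bi).
have mc : measurable_fun setT (fun x => (a x + b x)%:E) by apply/measurable_EFinP; mfun.
have mnb : measurable_fun setT (fun x => `|b x|%:E) by apply/measurable_EFinP; mfun.
have nbi := L1_norm bi.
have nbfin := integrable_lty measurableT nbi.
rewrite integralE.
have neg_fin : (\int[mu]_x (fun x => (a x + b x)%:E)^\- x < +oo)%E.
  apply: le_lt_trans nbfin; apply: ge0_le_integral => //; first exact: measurable_funeneg.
  move=> x _; rewrite funenegE ge_max; apply/andP; split; last by rewrite lee_fin.
  rewrite -EFinN lee_fin; have := a0 x; have := ler_norm (- b x); rewrite normrN; lra.
have posy : (\int[mu]_x (fun x => (a x + b x)%:E)^\+ x = +oo)%E.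
  apply/eqP; rewrite -leye_eq leNgt; apply/negP => posfin.
  have : (\int[mu]_x (a x)%:E <= \int[mu]_x (fun x => (a x + b x)%:E)^\+ x + \int[mu]_x `|b x|%:E)%E.
    rewrite -ge0_integralD//; last exact: measurable_funepos.
    apply: ge0_le_integral => //.
    - by move=> x _; rewrite lee_fin.
    - exact/measurable_EFinP.
    - by apply: emeasurable_funD => //; exact: measurable_funepos.
    - move=> x _; rewrite funeposE.
      apply: (@le_trans _ _ ((a x + b x)%:E + `|b x|%:E)%E).
        by rewrite -EFinD lee_fin; have := ler_norm (- b x); rewrite normrN; lra.
      by rewrite leeD2r// le_max lexx.
  by rewrite ay leye_eq lt_eqF// lte_add_pinfty.
have nf : (\int[mu]_x (fun x => (a x + b x)%:E)^\- x)%E \is a fin_num.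
  by rewrite ge0_fin_numE//; exact: integral_ge0.
by rewrite posy -(fineK nf) -EFinN addye.
Qed.

Lemma antiderivative2E (c : R -> R) z : L1 c ->
  antiderivative2 c z = (\int[mu]_v (prim c v * heaviside (z - v))%:E)%E.
Proof.
move=> ci; rewrite /antiderivative2 {1}/antiderivative integral_heaviside.
by apply: eq_integral => v _; rewrite antiderivativeE// EFinM.
Qed.

Section cdf.
Variable f : R -> R.
Hypotheses (fi : L1 f) (f0 : forall x, 0 <= f x) (f1 : \int[mu]_x f x = 1)
  (f2 : L1 (fun x => f x ^+ 2)).
Let mf := measurable_L1 fi.
Let F := prim f.
Let mF : measurable_fun setT F. Proof. exact: measurable_primitive. Qed.
Let F0 y : 0 <= F y. Proof. exact: primitive_ge0. Qed.
Let F1 y : F y <= 1. Proof. by rewrite -f1 primitive_le. Qed.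
Let F_bounded y : `|F y| <= 1. Proof. by rewrite ger0_norm. Qed.

(* Both sides are E(Y - X)^+ for independent X and Y with density f. *)
Lemma antiderivative2_autocorrelation :
  antiderivative2 (cross_correlation f f) 0 = (\int[mu]_x (F x * (1 - F x))%:E)%E.
Proof.
have mh := @measurable_heaviside R.
have ffi u : L1 (fun t => f t * f (t + u)).
  by apply: L1_mul => //; [mfun|exact: (L1_shift u f2)].
rewrite antiderivative2E; last exact: L1_cross_correlation.
have m1 : measurable_fun setT (fun q : R * R => (f q.2 * F (q.2 + q.1) * heaviside (0 - q.1))%:E).
  by apply/measurable_EFinP; mfun.
have m2 : measurable_fun setT (fun q : R * R => (f q.1 * F q.2 * heaviside (q.1 - q.2))%:E).
  by apply/measurable_EFinP; mfun.
transitivity (\int[mu]_v \int[mu]_t (f t * F (t + v) * heaviside (0 - v))%:E)%E.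
  apply: eq_integral => v _; rewrite primitive_cross_correlation// /cross_correlation.
  have fFi : L1 (fun t => f t * F (t + v)).
    by apply: (L1_mul_bounded fi _ (fun t => F_bounded (t + v))); mfun.
  rewrite -(RintegralZr _ measurableT fFi) /Rintegral fineK//.
  apply: integrable_fin_num => //.
  by apply: eq_L1 (L1Z (heaviside (0 - v)) fFi) => t; rewrite mulrC.
transitivity (\int[mu]_t \int[mu]_v (f t * F (t + v) * heaviside (0 - v))%:E)%E.
  apply: (@fubini_tonelli _ _ _ _ R mu mu (fun q : R * R => (f q.2 * F (q.2 + q.1) * heaviside (0 - q.1))%:E)) => //.
  by move=> q; rewrite lee_fin !mulr_ge0 ?heaviside_ge0.
transitivity (\int[mu]_t \int[mu]_y (f t * F y * heaviside (t - y))%:E)%E.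
  apply: eq_integral => t _.
  rewrite -(integral_shift t (f := fun y => (f t * F y * heaviside (t - y))%:E)); last first.
    by apply/measurable_EFinP; mfun.
  by apply: eq_integral => v _; rewrite opprD addrCA subrr addr0 sub0r (addrC v).
transitivity (\int[mu]_y \int[mu]_t (f t * F y * heaviside (t - y))%:E)%E.
  apply: (@fubini_tonelli _ _ _ _ R mu mu (fun q : R * R => (f q.1 * F q.2 * heaviside (q.1 - q.2))%:E)) => //.
  by move=> q; rewrite lee_fin !mulr_ge0 ?heaviside_ge0.
apply: eq_integral => y _.
have fhi : L1 (fun t => f t * heaviside (t - y)).
  by apply: (L1_mul_bounded fi _ (fun t => heaviside_bounded (t - y))); mfun.
transitivity (\int[mu]_t (F y * (f t * heaviside (t - y))))%:E.
  rewrite /Rintegral fineK; last by apply: integrable_fin_num => //; exact: L1Z.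
  by apply: eq_integral => t _; rewrite mulrA (mulrC (F y)).
by rewrite (RintegralZl _ measurableT fhi) primitive_compl// f1.
Qed.

Section kernel.
Variable kap : R -> R.
Hypotheses (ki : L1 kap) (k1 : \int[mu]_x kap x = 1)
  (ksym : forall x, kap (- x) = kap x) (k2 : L1 (fun x => kap x ^+ 2))
  (kxi : L1 (fun x => `|kap x| * `|x|)).
Let mk := measurable_L1 ki.
(* The derivative of (prim kap)^2. *)
Let w (x : R) : R := 2 * prim kap x * kap x.
Let eta := convolution kap f.
Let p := cross_correlation f f.

Let C := \int[mu]_x `|kap x|.
Let C0 : 0 <= C. Proof. exact: Rintegral_ge0. Qed.

Lemma L1_sqr_density : L1 w.
Proof.
apply: (@eq_L1 _ (fun x => 2 * (kap x * prim kap x))); first by move=> x; rewrite /w; ring.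
apply: L1Z; apply: (L1_mul_bounded ki (measurable_primitive ki)).
by move=> x; exact: primitive_bounded.
Qed.

(** By [primitive_sqr] the primitive of [w] is the square of that of [kap], which tends to 1. *)
Lemma Rintegral_sqr_density : \int[mu]_x w x = 1.
Proof.
have lim1 := cvg_primitive_addn 0 L1_sqr_density.
have lim2 : prim w (0 + n%:R) @[n --> \oo] --> (1 : R).
  rewrite (_ : (fun n : nat => _) =
      (fun n : nat => prim kap (0 + n%:R) * prim kap (0 + n%:R))); last first.
    by apply/funext => n; rewrite -expr2 primitive_sqr.
  have lim := cvg_primitive_addn 0 ki; rewrite k1 in lim.
  by rewrite -[X in _ --> X]mulr1; apply: cvgM.
exact: (cvg_unique _ lim1 lim2).
Qed.

Lemma L1_first_moment_sqr_density : L1 (fun x => `|w x| * `|x|).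
Proof.
have mw := measurable_L1 L1_sqr_density.
apply: (@le_L1 _ _ (fun x => (2 * C) * (`|kap x| * `|x|))); first by mfun.
  move=> x; rewrite normrM !normr_id mulrA ler_wpM2r// /w !normrM ler_wpM2r//.
  by rewrite ger0_norm// ler_wpM2l// primitive_bounded.
exact: L1Z.
Qed.

Lemma integral_variance :
  (\int[mu]_x (convolution w F x - convolution kap F x ^+ 2)%:E =
   antiderivative2 (cross_correlation eta eta) 0 - (\int[mu]_x (x * w x))%:E)%E.
Proof.
pose g := bias_density kap f.
pose s := sum_density kap f.
pose G := avg_increment kap F.
pose J := avg_increment w F.
have mh := @measurable_heaviside R.
have wi := L1_sqr_density.
have mw := measurable_L1 wi.
have [Gi _] := L1_avg_increment ki fi f0 f1 kxi.
have [Ji JE] := L1_avg_increment wi fi f0 f1 L1_first_moment_sqr_density.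
have ei : L1 eta := L1_smoothed ki fi.
have [GSi [Ai AE]] := antiderivative2_bias_sum ki k1 k2 fi f0 f1 f2 Gi.
have {}AE : antiderivative2 (cross_correlation g s) 0 = (- \int[mu]_y (G y * prim s y))%:E by exact AE.
have {}JE : \int[mu]_y J y = - \int[mu]_x (x * w x) by exact JE.
have {}GSi : L1 (fun y => G y * prim s y) by exact GSi.
have {}Ji : L1 J by exact Ji.
have mh0 : measurable_fun setT (fun v : R => heaviside (0 - v)) by mfun.
have eei : L1 (cross_correlation eta eta) by exact: L1_cross_correlation.
have pi : L1 p by exact: L1_cross_correlation.
have p0 v : 0 <= p v by apply: Rintegral_ge0 => t _; rewrite mulr_ge0.
(* This separates the part that may have an infinite integral over the negative half-line, the
   nonnegative [prim p], from an integrable remainder. *)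
have primE v : prim (cross_correlation eta eta) v = prim p v + prim (cross_correlation g s) v.
  rewrite (_ : cross_correlation g s = fun u => cross_correlation eta eta u - p u).
    by rewrite (primitiveB v eei pi) addrCA subrr addr0.
  by apply/funext => u; rewrite cross_correlation_bias_sum.
have Ahi : L1 (fun v => prim (cross_correlation g s) v * heaviside (0 - v)).
  exact: (L1_mul_bounded Ai mh0 (fun v => heaviside_bounded _)).
have mP : measurable_fun setT (prim p) by exact: measurable_primitive.
have gsi : L1 (cross_correlation g s).
  by apply: L1_cross_correlation; [exact: L1_bias_density|exact: L1_sum_density].
have -> : (antiderivative2 (cross_correlation eta eta) 0 =
    \int[mu]_x (F x * (1 - F x))%:E + (- \int[mu]_y (G y * prim s y))%:E)%E.
  rewrite -antiderivative2_autocorrelation -AE !antiderivative2E//.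
  rewrite -ge0_integralD_L1//; [|by mfun|by move=> v; rewrite mulr_ge0 ?heaviside_ge0 ?primitive_ge0].
  by apply: eq_integral => v _; rewrite primE mulrDl.
have kfi y : L1 (fun t => kap t * f (y - t)).
  by apply: L1_mul => //; [mfun|exact: (L1_reflect y f2)].
(* [F] and [F^2] are added and subtracted; the difference of the two squares factors as
   [G x * prim s x]. *)
have VE x : convolution w F x - convolution kap F x ^+ 2 =
    F x * (1 - F x) + (J x - G x * prim s x).
  rewrite /J /G (avg_increment_convolution ki k1 x mF F_bounded).
  rewrite (avg_increment_convolution wi Rintegral_sqr_density x mF F_bounded).
  rewrite /s /sum_density primitiveD// (primitive_convolution ki fi kfi).
  by rewrite -/F; ring.
transitivity (\int[mu]_x (F x * (1 - F x) + (J x - G x * prim s x))%:E)%E.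
  by apply: eq_integral => x _; rewrite VE.
have JGi : L1 (fun x => J x - G x * prim s x) by exact: L1B.
rewrite ge0_integralD_L1//; [|by mfun|by move=> x; rewrite mulr_ge0// subr_ge0].
(* Both sides carry the same possibly infinite integral of [F (1 - F)]; it is matched, not
   cancelled, and only finite integrals remain. *)
rewrite -[RHS]addeA; congr (_ + _)%E.
transitivity (\int[mu]_x (J x - G x * prim s x))%:E.
  exact: esym (fineK (integrable_fin_num measurableT JGi)).
by rewrite (RintegralB measurableT Ji GSi) JE -EFinN -EFinD addrC.
Qed.
End kernel.
End cdf.
End variance_integral.

(** * Moments of the estimator *)

Section expectations.
Context {R : realType} d (T : measurableType d) (P : probability T R).
Notation mu := (@lebesgue_measure R).
Notation L1 f := (mu.-integrable setT (EFin \o f)).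
Notation prim f := (convolution f heaviside).

Lemma integrable_bounded (Y : T -> R) C : measurable_fun setT Y ->
  (forall w, `|Y w| <= C) -> P.-integrable setT (EFin \o Y).
Proof.
move=> mY YC; apply: (@le_integrable _ _ _ P setT measurableT _ (EFin \o cst C)).
- exact/measurable_EFinP.
- by move=> w _; rewrite lee_fin (le_trans (YC w)) ?ler_norm.
- exact: finite_measure_integrable_cst.
Qed.

Lemma measurable_heaviside_subr (X : T -> R) y : measurable_fun setT X ->
  measurable_fun setT (fun w => heaviside (y - X w)).
Proof. by move=> mX; have mh := @measurable_heaviside R; mfun. Qed.

Lemma heaviside_subr_indic (X : T -> R) y w :
  heaviside (y - X w) = \1_(X @^-1` `]-oo, y]) w.
Proof.
by rewrite indicE /heaviside subr_ge0; congr (nat_of_bool _)%:R;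
  apply/idP/idP; rewrite inE/= in_itv.
Qed.

(** The primitive at [x - X] averages, with weights [kap t], the indicators of [X <= x - t].
    Exchanging expectation and average leaves the values [F (x - t)], without transporting [P] to
    the line. *)
Lemma Rintegral_primitive (kap F : R -> R) (X : T -> R) x : L1 kap ->
  measurable_fun setT X ->
  (forall y, P (X @^-1` `]-oo, y]) = (F y)%:E) ->
  \int[P]_w prim kap (x - X w) = convolution kap F x.
Proof.
move=> ki mX XF; have mh := @measurable_heaviside R.
have i1 : P.-integrable setT (EFin \o (cst 1 : T -> R)).
  exact: finite_measure_integrable_cst.
have mX1 : measurable_fun setT (fun q : T * R => X q.1) by exact: measurableT_comp.
have [||_ _ s] := @Rfubini_prod _ _ _ _ R P mu (cst 1) kap
  (fun w t => heaviside (x - X w - t)) 1 i1 ki.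
- by mfun.
- by move=> w t; exact: heaviside_bounded.
transitivity (\int[P]_w \int[mu]_t (cst 1 w * kap t * heaviside (x - X w - t))).
  by apply: eq_Rintegral => w _; apply: eq_Rintegral => t _; rewrite mul1r.
rewrite s; apply: eq_Rintegral => t _.
transitivity (\int[P]_w (kap t * heaviside ((x - t) - X w))).
  by apply: eq_Rintegral => w _; rewrite mul1r (addrAC x).
have hi : P.-integrable setT (EFin \o (fun w => heaviside ((x - t) - X w))).
  apply: (integrable_bounded (C := 1)) => [|w]; last exact: heaviside_bounded.
  exact: measurable_heaviside_subr.
rewrite (RintegralZl _ measurableT hi); congr (_ * _).
rewrite /Rintegral; under eq_integral do rewrite heaviside_subr_indic.
have mXi : measurable (X @^-1` `]-oo, x - t]) by rewrite -[X in measurable X]setTI; exact: mX.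
by rewrite integral_indic// setIT; exact: (congr1 fine (XF (x - t))).
Qed.

Lemma primitive_subr_bounded (kap : R -> R) (X : T -> R) x : L1 kap ->
  measurable_fun setT X ->
  measurable_fun setT (fun w => prim kap (x - X w)) /\
  forall w, `|prim kap (x - X w)| <= \int[mu]_t `|kap t|.
Proof.
move=> ki mX; have mp := measurable_primitive ki.
by split=> [|w]; [mfun|exact: primitive_bounded].
Qed.

(** The two factors are unfolded into indicators one after the other, so independence enters only
    through pairs of half-lines. *)
Lemma Rintegral_primitive_indep (kap F : R -> R) (X Y : T -> R) x : L1 kap ->
  measurable_fun setT X -> measurable_fun setT Y ->
  measurable_fun setT F -> (forall y, `|F y| <= 1) ->
  (forall y z, P (X @^-1` `]-oo, y] `&` Y @^-1` `]-oo, z]) = (F y * F z)%:E) ->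
  \int[P]_w (prim kap (x - X w) * prim kap (x - Y w)) = convolution kap F x ^+ 2.
Proof.
move=> ki mX mY mF F1 XYF; have mh := @measurable_heaviside R.
have mp := measurable_primitive ki.
have [mYp Yb] := primitive_subr_bounded x ki mY.
have i1 : P.-integrable setT (EFin \o (cst 1 : T -> R)).
  exact: finite_measure_integrable_cst.
have mX1 : measurable_fun setT (fun q : T * R => X q.1) by exact: measurableT_comp.
have mY1 : measurable_fun setT (fun q : T * R => Y q.1) by exact: measurableT_comp.
have mhX y : measurable_fun setT (fun w => heaviside (y - X w)).
  exact: measurable_heaviside_subr.
have mhX1 y : measurable_fun setT (fun q : T * R => heaviside (y - X q.1)) by mfun.
pose C := \int[mu]_t `|kap t|.
have C0 : 0 <= C by exact: Rintegral_ge0.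
have kFi : L1 (fun t => kap t * F (x - t)).
  by apply: (L1_mul_bounded ki _ (fun t => F1 (x - t))); mfun.
have hC (y z w : R) : `|z| <= w -> `|heaviside y * z| <= w.
  move=> zw; rewrite normrM -[leRHS]mul1r ler_pM// heaviside_bounded//.
(* Here [X] is already reduced to an indicator and only the factor in [Y] is unfolded. *)
have inner y : \int[P]_w (heaviside (y - X w) * prim kap (x - Y w)) =
    F y * convolution kap F x.
  have [||_ _ s] := @Rfubini_prod _ _ _ _ R P mu (cst 1) kap
    (fun w t => heaviside (y - X w) * heaviside (x - Y w - t)) 1 i1 ki.
  - by mfun.
  - by move=> w t; apply: hC; exact: heaviside_bounded.
  transitivity (\int[P]_w \int[mu]_t (cst 1 w * kap t * (heaviside (y - X w) * heaviside (x - Y w - t)))).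
    apply: eq_Rintegral => w _.
    rewrite -(RintegralZl _ measurableT (L1_heaviside (x - Y w) ki)).
    by apply: eq_Rintegral => t _; rewrite mul1r mulrCA.
  rewrite s.
  transitivity (\int[mu]_t (F y * (kap t * F (x - t)))).
    apply: eq_Rintegral => t _.
    transitivity (\int[P]_w (kap t * (heaviside (y - X w) * heaviside ((x - t) - Y w)))).
      by apply: eq_Rintegral => w _; rewrite mul1r (addrAC x).
    have hi : P.-integrable setT (EFin \o (fun w => heaviside (y - X w) * heaviside ((x - t) - Y w))).
      apply: (integrable_bounded (C := 1)) => [|w]; last by apply: hC; exact: heaviside_bounded.
      by mfun.
    rewrite (RintegralZl _ measurableT hi) mulrCA; congr (_ * _).
    have hXY w : heaviside (y - X w) * heaviside ((x - t) - Y w) =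
        \1_(X @^-1` `]-oo, y] `&` Y @^-1` `]-oo, x - t]) w.
      by rewrite indicI/= !heaviside_subr_indic.
    rewrite /Rintegral; under eq_integral do rewrite hXY.
    have mXi : measurable (X @^-1` `]-oo, y]) by rewrite -[X in measurable X]setTI; exact: mX.
    have mYi : measurable (Y @^-1` `]-oo, x - t]) by rewrite -[X in measurable X]setTI; exact: mY.
    rewrite integral_indic ?setIT//; last exact: measurableI.
    exact: (congr1 fine (XYF y (x - t))).
  by rewrite (RintegralZl _ measurableT kFi).
have mp2 : measurable_fun setT (fun q : T * R => prim kap (x - Y q.1)) by mfun.
have [||_ _ s] := @Rfubini_prod _ _ _ _ R P mu (cst 1) kap
  (fun w t => heaviside (x - X w - t) * prim kap (x - Y w)) C i1 ki.
- by mfun.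
- by move=> w t; exact: hC.
transitivity (\int[P]_w \int[mu]_t (cst 1 w * kap t * (heaviside (x - X w - t) * prim kap (x - Y w)))).
  apply: eq_Rintegral => w _.
  rewrite {1}/convolution -(RintegralZr _ measurableT (L1_heaviside (x - X w) ki)).
  by apply: eq_Rintegral => t _; rewrite mul1r mulrA.
rewrite s.
transitivity (\int[mu]_t (kap t * F (x - t) * convolution kap F x)).
  apply: eq_Rintegral => t _.
  transitivity (\int[P]_w (kap t * (heaviside ((x - t) - X w) * prim kap (x - Y w)))).
    by apply: eq_Rintegral => w _; rewrite mul1r (addrAC x).
  have hi : P.-integrable setT (EFin \o (fun w => heaviside ((x - t) - X w) * prim kap (x - Y w))).
    apply: (integrable_bounded (C := C)) => [|w]; last exact: hC.
    by apply: measurable_funM; [exact: mhX|exact: mYp].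
  by rewrite (RintegralZl _ measurableT hi) inner mulrA.
by rewrite (RintegralZr _ measurableT kFi) expr2.
Qed.

End expectations.

(** * Mean and variance of an average of bounded uncorrelated variables *)

Section estimator.
Context {R : realType} d (T : measurableType d) (P : probability T R).
Notation mu := (@lebesgue_measure R).
Notation L1 f := (mu.-integrable setT (EFin \o f)).
Notation prim f := (convolution f heaviside).
Variables (n : nat) (U : 'I_n -> T -> R) (C m1 m2 : R).
Hypotheses (n_gt0 : (0 < n)%N) (mU : forall i, measurable_fun setT (U i))
  (UC : forall i w, `|U i w| <= C)
  (EU : forall i, \int[P]_w U i w = m1)
  (EU2 : forall i, \int[P]_w U i w ^+ 2 = m2)
  (EUU : forall i j, i != j -> \int[P]_w (U i w * U j w) = m1 ^+ 2).

Let mean w := n%:R^-1 * \sum_(i < n) U i w.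
Let n_neq0 : n%:R != 0 :> R. Proof. by rewrite pnatr_eq0 -lt0n. Qed.

Lemma Rintegral_sum (I : finType) (h : I -> T -> R) :
  (forall i, P.-integrable setT (EFin \o h i)) ->
  P.-integrable setT (EFin \o (fun w => \sum_(i in I) h i w)) /\
  \int[P]_w (\sum_(i in I) h i w) = \sum_(i in I) \int[P]_w h i w.
Proof.
move=> hi.
have E : (EFin \o (fun w => \sum_(i in I) h i w)) = (fun w : T => \sum_(i in I) (h i w)%:E)%E.
  by apply/funext => w /=; rewrite sumEFin.
split; first by rewrite E; apply: integrable_sum => // i _; exact: hi.
rewrite {1}/Rintegral -[X in fine X]/(\int[P]_w (EFin \o (fun w : T => \sum_(i in I) h i w)%R) w)%E E.
rewrite integral_sum//= -EFin_sum_fine// => i _.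
by apply: integrable_fin_num => //; exact: hi.
Qed.

Let Ui i : P.-integrable setT (EFin \o U i).
Proof. exact: integrable_bounded (UC i). Qed.

Lemma expectation_mean : ('E_P[mean] = m1%:E)%E.
Proof.
have [si sE] := Rintegral_sum Ui.
rewrite unlock; transitivity (\int[P]_w mean w)%:E.
  rewrite /Rintegral fineK//; apply: integrable_fin_num => //.
  exact: (integrableZl measurableT n%:R^-1 si).
congr EFin; rewrite (RintegralZl _ measurableT si) sE.
under eq_bigr do rewrite EU.
by rewrite sumr_const card_ord -(mulr_natl m1 n) mulrA mulVf// mul1r.
Qed.

(** The square of the centred sum is a sum over pairs [q] of indices: pairs of distinct indices have
    expectation 0, and the [n] diagonal ones give [m2 - m1 ^+ 2] each, against a prefactor
    [n^(-2)]. *)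
Lemma variance_mean : ('V_P[mean] = ((m2 - m1 ^+ 2) / n%:R)%:E)%E.
Proof.
rewrite /variance covariance.unlock expectation_mean /= expectation.unlock /=.
pose D (q : 'I_n * 'I_n) w := (U q.1 w - m1) * (U q.2 w - m1).
have UUi i j : P.-integrable setT (EFin \o (fun w => U i w * U j w)).
  apply: (@integrable_bounded _ _ _ P _ (C * C)) => [|w]; first exact: measurable_funM.
  by rewrite normrM ler_pM.
have cst1 (c : R) : P.-integrable setT (EFin \o (fun _ : T => c)).
  exact: finite_measure_integrable_cst.
have DE q w : D q w = (U q.1 w * U q.2 w - m1 * U q.1 w) - (m1 * U q.2 w - m1 ^+ 2).
  by rewrite /D; ring.
have i1 q : P.-integrable setT (EFin \o (fun w => U q.1 w * U q.2 w - m1 * U q.1 w)).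
  exact: (integrableB measurableT (UUi q.1 q.2) (integrableZl measurableT m1 (Ui q.1))).
have i2 (q : 'I_n * 'I_n) : P.-integrable setT (EFin \o (fun w => m1 * U q.2 w - m1 ^+ 2)).
  exact: (integrableB measurableT (integrableZl measurableT m1 (Ui q.2)) (cst1 (m1 ^+ 2))).
have Di q : P.-integrable setT (EFin \o D q).
  rewrite (_ : D q = fun w => (U q.1 w * U q.2 w - m1 * U q.1 w) - (m1 * U q.2 w - m1 ^+ 2)).
    exact: (integrableB measurableT (i1 q) (i2 q)).
  by apply/funext => w; rewrite DE.
have c1 : \int[P]_w (m1 ^+ 2) = m1 ^+ 2.
  by rewrite /Rintegral integral_cst//= probability_setT mule1.
have EE q : \int[P]_w D q w = if q.1 == q.2 then m2 - m1 ^+ 2 else 0.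
  transitivity (\int[P]_w ((U q.1 w * U q.2 w - m1 * U q.1 w) - (m1 * U q.2 w - m1 ^+ 2))).
    by apply: eq_Rintegral => w _; rewrite DE.
  rewrite (RintegralB measurableT (i1 q) (i2 q)).
  rewrite (RintegralB measurableT (UUi q.1 q.2) (integrableZl measurableT m1 (Ui q.1))).
  rewrite (RintegralB measurableT (integrableZl measurableT m1 (Ui q.2)) (cst1 (m1 ^+ 2))).
  rewrite !(RintegralZl _ measurableT (Ui _)) !EU c1.
  rewrite expr2 subrr subr0; case: eqVneq => [->|ne]; last by rewrite EUU// expr2 subrr.
  by rewrite -(EU2 q.2); congr (_ - _); apply: eq_Rintegral => w _; rewrite expr2.
have [si sE] := Rintegral_sum Di.
have mE w : (mean w - m1) * (mean w - m1) = (n%:R^-1 ^+ 2) * \sum_(q in {: 'I_n * 'I_n}) D q w.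
  have -> : \sum_(q in {: 'I_n * 'I_n}) D q w = (\sum_(i < n) (U i w - m1)) * (\sum_(j < n) (U j w - m1)).
    rewrite big_distrl/= -(pair_big xpredT xpredT (fun i j => D (i, j) w))/=.
    by apply: eq_bigr => i _; rewrite big_distrr.
  have -> : mean w - m1 = n%:R^-1 * \sum_(i < n) (U i w - m1).
    by rewrite sumrB sumr_const card_ord -(mulr_natl m1 n) mulrBr mulrA mulVf// mul1r.
  by ring.
transitivity (\int[P]_w (n%:R^-1 ^+ 2 * \sum_(q in {: 'I_n * 'I_n}) D q w))%:E.
  rewrite /Rintegral fineK; last first.
    by apply: integrable_fin_num => //; exact: (integrableZl measurableT (n%:R^-1 ^+ 2) si).
  by apply: eq_integral => w _; rewrite -mE.
congr EFin; rewrite (RintegralZl _ measurableT si) sE.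
under eq_bigr do rewrite EE.
rewrite -(pair_big xpredT xpredT (fun i j : 'I_n => if i == j then m2 - m1 ^+ 2 else 0))/=.
have -> : \sum_(i < n) \sum_(j < n) (if i == j then m2 - m1 ^+ 2 else 0) = n%:R * (m2 - m1 ^+ 2).
  under eq_bigr => i _.
    rewrite (bigD1 i)//= eqxx big1 ?addr0; last by move=> j /negbTE; rewrite eq_sym => ->.
    over.
  by rewrite sumr_const card_ord -(mulr_natl (m2 - m1 ^+ 2) n).
by field.
Qed.

End estimator.

(** * Integrability and normalization drawn from the hypotheses of the theorem *)

Section hypotheses.
Context {R : realType}.
Notation mu := (@lebesgue_measure R).
Notation L1 f := (mu.-integrable setT (EFin \o f)).
Notation prim f := (convolution f heaviside).

Lemma square_integrableP (f : R -> R) : square_integrable f ->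
  measurable_fun setT f /\ L1 (fun x => f x ^+ 2).
Proof.
move=> f2; split; last exact: Lfun2_integrable_sqr.
by move: f2; rewrite /square_integrable inE => /andP[+ _]; rewrite inE.
Qed.

(** A finite extended-real integral forces the integral of the absolute value to be finite. This
    supplies the integrability of the kernel. *)
Lemma integral_eq1_L1 (f : R -> R) : measurable_fun setT f ->
  (\int[mu]_x (f x)%:E = 1)%E -> L1 f /\ \int[mu]_x f x = 1.
Proof.
move=> mf f1; have mfE : measurable_fun setT (EFin \o f) by exact/measurable_EFinP.
split; last by rewrite /Rintegral f1.
apply/integrableP; split => //.
by rewrite (integral_fin_num_abs mu measurableT mf) f1.
Qed.

(** Total mass is not part of [has_density]. The integrals over []-oo, n]] equal [F n <= 1], so
    monotone convergence gives integrability; the mass is then the limit of the distribution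
    function at [+oo]. *)
Lemma cdf_densityP d (T : measurableType d) (P : probability T R)
    (X : {RV P >-> R}) (F f : R -> R) :
  (forall x, cdf X x = (F x)%:E) -> has_density F f ->
  [/\ L1 f, \int[mu]_x f x = 1 & F = prim f].
Proof.
move=> XF [mf f0 Ff]; have mh := @measurable_heaviside R.
have F1 x : F x <= 1 by rewrite -lee_fin -XF cdf_le1.
have fi : L1 f.
  apply/integrableP; split; first exact/measurable_EFinP.
  rewrite (_ : (\int[mu]_x _)%E = (\int[mu]_x (f x)%:E)%E); last first.
    by apply: eq_integral => x _; rewrite /= ger0_norm.
  apply: (@le_lt_trans _ _ 1%E); last by rewrite ltry.
  pose g n x : \bar R := (f x * heaviside (n%:R - x))%:E.
  have cvgf : (\int[mu]_x g n x)%E @[n --> \oo] --> (\int[mu]_x limn (g ^~ x))%E.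
    apply: cvg_monotone_convergence => //.
    - by move=> n; apply/measurable_EFinP; mfun.
    - by move=> n x _; rewrite lee_fin mulr_ge0 ?heaviside_ge0.
    - move=> x _ n m nm; rewrite lee_fin ler_wpM2l// /heaviside ler_nat !subr_ge0.
      case: (leP x n%:R) => // xn; rewrite (le_trans xn)// ler_nat//.
  have fE x : limn (g ^~ x) = (f x)%:E.
    apply/cvg_lim => //; apply: cvg_near_cst; near=> n.
    rewrite /g /heaviside subr_ge0 ltW ?mulr1//.
    by near: n; exact: nbhs_infty_gtr.
  have {}cvgf : (\int[mu]_x g n x)%E @[n --> \oo] --> (\int[mu]_x (f x)%:E)%E.
    by rewrite (_ : (\int[mu]_x (f x)%:E)%E = (\int[mu]_x limn (g ^~ x))%E)//;
      apply: eq_integral => x _; rewrite fE.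
  rewrite -(cvg_lim _ cvgf)//; apply: lime_le; first by apply: cvgP cvgf.
  apply: nearW => n; apply: (@le_trans _ _ (F n%:R)%:E); last by rewrite lee_fin.
  rewrite Ff /antiderivative integral_heaviside.
  by under [leRHS]eq_integral do rewrite -EFinM.
have FE : F = prim f.
  by apply/funext => x; apply: EFin_inj; rewrite Ff antiderivativeE.
split=> //.
have lim1 := cvg_primitive_addn 0 fi.
have lim2 : prim f (0 + n%:R) @[n --> \oo] --> (1 : R).
  have h : cdf X n%:R @[n --> \oo] --> 1%E.
    by have /cvge_pinftyP := cvg_cdfy1 X; apply; exact/cvgryPge/nbhs_infty_ger.
  rewrite (_ : (fun n : nat => prim f (0 + n%:R)) = fine \o (fun n : nat => cdf X n%:R)).
    exact: fine_cvg h.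
  by apply/funext => n; rewrite /= XF/= FE add0r.
exact: (cvg_unique _ lim1 lim2).
Unshelve. all: by end_near. Qed.

Lemma cdf_indep d (T : measurableType d) (P : probability T R) (I : finType)
    (X : I -> {RV P >-> R}) (F : R -> R) : mutually_independent X ->
  (forall i x, cdf (X i) x = (F x)%:E) -> forall i j, i != j -> forall y z,
  P (X i @^-1` `]-oo, y] `&` X j @^-1` `]-oo, z]) = (F y * F z)%:E.
Proof.
move=> Xind XF i j ij y z.
pose B l : set R := if l == i then `]-oo, y]%classic else `]-oo, z]%classic.
have mB l : measurable (B l) by rewrite /B; case: ifP.
have Bi : B i = `]-oo, y]%classic by rewrite /B eqxx.
have Bj : B j = `]-oo, z]%classic by rewrite /B eq_sym (negbTE ij).
have := Xind [set i; j]%SET B (fun l _ => mB l).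
rewrite big_setU1/= ?inE// big_set1 Bi Bj.
have -> : \bigcap_(l in [set` [set i; j]%SET]) (X l @^-1` B l) =
    X i @^-1` `]-oo, y] `&` X j @^-1` `]-oo, z].
  apply/seteqP; split=> w.
    move=> h; split.
      by have := h i; rewrite Bi; apply; rewrite /= !inE eqxx.
    by have := h j; rewrite Bj; apply; rewrite /= !inE eqxx orbT.
  by move=> [hi hj] l; rewrite /= !inE => /orP[]/eqP ->; rewrite ?Bi ?Bj.
move=> ->; rewrite EFinM; congr (_ * _)%E.
- exact: (XF i y).
- exact: (XF j z).
Qed.

End hypotheses.

Theorem theorem1 (R : realType) (d : measure_display) (T : measurableType d)
    (P : probability T R) (n : nat) (X : 'I_n -> {RV P >-> R})
    (F f k : R -> R) (h : R)
    (n_gt0 : (0 < n)%N)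
    (X_indep : mutually_independent X)
    (X_cdf : forall i x, cdf (X i) x = (F x)%:E)
    (F_density : has_density F f)
    (f_L2 : square_integrable f)
    (k_sym : symmetric_about_origin k)
    (k_L2 : square_integrable k)
    (k_int : (\int[@lebesgue_measure R]_t (k t)%:E = 1)%E)
    (k_lim : t ^+ 2 * k t @[t --> +oo] --> 0)
    (h_gt0 : 0 < h) :
  let Fhat := kernel_cdf_estimator X k h in
  let eta := smoothed_density k h f in
  [/\ symmetric_about_origin (xi eta f),
      (\int[@lebesgue_measure R]_u (xi eta f u)%:E = 0)%E,
      integrated_squared_bias P Fhat F = (- antiderivative2 (xi eta f) 0)%E &
      (@lebesgue_measure R).-integrable setT (EFin \o psi_integrand k) ->
      integrated_variance P Fhat =
        (- (h / n%:R)%:E * psi k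
         + n%:R^-1%:E * antiderivative2 (cross_correlation eta eta) 0)%E].
Proof.
move=> Fhat eta.
have [mk k2] := square_integrableP k_L2.
have [mf f2] := square_integrableP f_L2.
have [ki k1] := integral_eq1_L1 mk k_int.
(* The sample is nonempty, and its first variable makes [F] a genuine distribution function. *)
have [fi f1 FE] := cdf_densityP (X_cdf (Ordinal n_gt0)) F_density.
have f0 : forall x, 0 <= f x by case: F_density.
pose kap := rescaled k h.
have kapi : lebesgue_measure.-integrable setT (EFin \o kap) := L1_rescaled ki h_gt0.
have kap1 : \int[lebesgue_measure]_x kap x = 1 by rewrite Rintegral_rescaled.
have kapsym := rescaled_even h k_sym.
have kap2 := L1_sqr_rescaled h_gt0 k2.
have kaps := L1_sqrt_moment_rescaled h_gt0 (L1_sqrt_moment ki k_sym k_lim).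
have mF : measurable_fun setT F by rewrite FE; exact: measurable_primitive.
have F_bounded y : `|F y| <= 1.
  by rewrite FE ger0_norm ?primitive_ge0// -f1 primitive_le.
pose U x i w := convolution kap heaviside (x - X i w).
have FhatE x : Fhat x = fun w => n%:R^-1 * \sum_(i < n) U x i w.
  apply/funext => w; rewrite /Fhat /kernel_cdf_estimator; congr (_ * _).
  by apply: eq_bigr => i _; rewrite integrated_kernelE /U /kap primitive_rescaled.
(* The square of the primitive of [kap] is the primitive of [w2], so second moments follow from the
   same formula as first moments. *)
pose w2 x := 2 * convolution kap heaviside x * kap x.
have w2i : lebesgue_measure.-integrable setT (EFin \o w2) := L1_sqr_density kapi.
pose H x := convolution kap F x.
pose M x := convolution w2 F x.
have mX i : measurable_fun setT (X i) by [].
have XF i y : P (X i @^-1` `]-oo, y]) = (F y)%:E by exact: (X_cdf i y).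
have mU x i : measurable_fun setT (U x i) := (primitive_subr_bounded x kapi (mX i)).1.
have Ub x i w : `|U x i w| <= \int[lebesgue_measure]_t `|kap t| :=
  (primitive_subr_bounded x kapi (mX i)).2 w.
have EU x i : \int[P]_w U x i w = H x := Rintegral_primitive x kapi (mX i) (XF i).
have EU2 x i : \int[P]_w U x i w ^+ 2 = M x.
  rewrite /M -(Rintegral_primitive x w2i (mX i) (XF i)).
  by apply: eq_Rintegral => w _; rewrite /U primitive_sqr.
have EUU x i j : i != j -> \int[P]_w (U x i w * U x j w) = H x ^+ 2.
  move=> ij; apply: (Rintegral_primitive_indep x kapi (mX i) (mX j) mF F_bounded).
  exact: (cdf_indep X_indep X_cdf ij).
have EFhat x : ('E_P[Fhat x] = (H x)%:E)%E.
  by rewrite FhatE; exact: (expectation_mean n_gt0 (mU x) (Ub x) (EU x)).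
have VFhat x : ('V_P[Fhat x] = ((M x - H x ^+ 2) / n%:R)%:E)%E.
  by rewrite FhatE; exact: (variance_mean n_gt0 (mU x) (Ub x) (EU x) (EU2 x) (EUU x)).
have xi_int := Rintegral_xi kapi kap1 kapsym kap2 fi f1 f2.
have xi_L1 := L1_xi kapi kapsym kap2 fi f2.
split.
- exact: (xi_even kapi kapsym kap2 fi f2).
- by rewrite -[LHS]fineK ?(integrable_fin_num measurableT xi_L1)//; congr EFin.
- have [G2 ->] := antiderivative2_xi kapi kap1 kapsym kap2 fi f0 f1 f2 kaps.
  rewrite /integrated_squared_bias EFinN oppeK.
  rewrite /Rintegral fineK; last exact: (integrable_fin_num measurableT G2).
  apply: eq_integral => x _; rewrite EFhat -EFinB -EFin_expe.
  rewrite -FE (avg_increment_convolution kapi kap1 x mF F_bounded) //.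
- move=> psii.
  have kx1 : lebesgue_measure.-integrable setT (EFin \o (fun x => `|k x| * `|x|)).
    apply: (L1_first_moment ki k_sym k1).
    by apply: eq_L1 psii => x; rewrite /psi_integrand integrated_kernelE.
  have kapx1 := L1_first_moment_rescaled h_gt0 kx1.
  have VI := integral_variance fi f0 f1 f2 kapi kap1 kapsym kap2 kapx1.
  rewrite -FE in VI.
  have n0 : 0 < n%:R^-1 :> R by rewrite invr_gt0 ltr0n.
  rewrite /integrated_variance.
  transitivity (n%:R^-1%:E * \int[lebesgue_measure]_x (M x - H x ^+ 2)%:E)%E.
    rewrite -ge0_integralZl//.
    + by apply: eq_integral => x _; rewrite VFhat -EFinM mulrC.
    + apply/measurable_EFinP; apply: measurable_funB.
        by apply: measurable_convolution => //; exact: measurable_L1 w2i.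
      by apply: measurable_funX; apply: measurable_convolution => //; exact: measurable_L1 kapi.
    (* The factor [1/n] leaves a possibly infinite integral because the integrand is nonnegative,
       which is read off from the variance itself. *)
    + move=> x _; have := variance_ge0 P (Fhat x).
      by rewrite VFhat !lee_fin pmulr_lge0.
  (* Distributing over the difference is legitimate although the antiderivative may be [+oo],
     because the subtracted moment is finite. *)
  rewrite [X in (_ * X)%E]VI muleBr//; last by rewrite fin_num_adde_defl.
  rewrite addeC -(psi_rescaled ki h_gt0 psii); congr (_ + _)%E.
  by rewrite muleA -EFinM mulNe (mulrC h).
Qed.
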